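(* Let $1\le k\le n$, $l\ge 1$, $d\ge 1$ be integers, $\Theta\subset\mathbb{R}^d$, and let $k(\cdot,\cdot):\Theta\times\Theta\to[-1,1]$ be a correlation function. Let $\boldsymbol\theta_1,\dots,\boldsymbol\theta_l,\boldsymbol\theta_*\in\Theta$, and let $\mathbf{K}_l=[k(\boldsymbol\theta_i,\boldsymbol\theta_j)]_{i,j=1}^l$ and $\mathbf{k}_l=(k(\boldsymbol\theta_*,\boldsymbol\theta_i))_{i=1}^l\in\mathbb{R}^l$. Let $\mathbf{X}_1,\dots,\mathbf{X}_l$ be $n\times k$ real matrices with orthonormal columns, let $\mathfrak{X}_i=\mathrm{span}(\mathbf{X}_i)$ be the $k$-dimensional subspace of $\mathbb{R}^n$ spanned by the columns of $\mathbf{X}_i$, and let $\mathfrak{X}=(\mathfrak{X}_i)_{i=1}^l$. Let $\mathbf{X}=[\mathbf{X}_1~\cdots~\mathbf{X}_l]$ be the $n\times kl$ matrix that combines the $\mathbf{X}_i$ by columns, and let $\mathbb{X}=\mathrm{diag}(\mathbf{X}_i)_{i=1}^l$ be the $nl\times kl$ block-diagonal matrix with the $\mathbf{X}_i$ as diagonal blocks. Assume that $\mathbf{K}_l$ is invertible and that all entries of $\mathbf{v}=\mathbf{K}_l^{-1}\mathbf{k}_l$ are nonzero. Let $\varepsilon^2=1-\mathbf{k}_l^T\mathbf{K}_l^{-1}\mathbf{k}_l$, $\mathbf{D}_{\mathbf{v}}=\mathrm{diag}(\mathbf{v})$, and $\widetilde{\mathbf{K}}_l=(\mathbf{D}_{\mathbf{v}}\mathbf{K}_l\mathbf{D}_{\mathbf{v}})^{-1}$.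 Then, in the Gaussian process subspace regression model described in the context, the predictive distribution of $\mathbf{m}_*$ given the observations $\mathfrak{X}$ is $$\mathbf{m}_*\,|\,\mathfrak{X}\sim N_{nk}(0,\ \mathbf{I}_k\otimes\boldsymbol{\Sigma}),\qquad \boldsymbol{\Sigma}=\varepsilon^2\mathbf{I}_n+\mathbf{X}\,[\mathbb{X}^T(\widetilde{\mathbf{K}}_l\otimes\mathbf{I}_n)\mathbb{X}]^{-1}\mathbf{X}^T .$$
   Context: Notation: $\mathrm{vec}(\cdot)$ stacks the columns of a matrix into one vector; $\otimes$ is the Kronecker product; $\mathbf{I}_m$ is the identity matrix of order $m$; $N_m(\boldsymbol\mu,\mathbf{C})$ is the $m$-dimensional Gaussian distribution with mean $\boldsymbol\mu$ and (possibly singular) covariance matrix $\mathbf{C}$. A correlation function is a positive definite kernel (symmetric, with all matrices $[k(\boldsymbol\theta_i,\boldsymbol\theta_j)]$ positive semidefinite) with $k(\boldsymbol\theta,\boldsymbol\theta)=1$ for all $\boldsymbol\theta\in\Theta$. Gaussian process subspace regression model. (1) Prior. The random vectors $\mathbf{m}_*\in\mathbb{R}^{nk}$ and $\mathbf{m}=(\mathbf{m}_i)_{i=1}^l\in\mathbb{R}^{nkl}$ (stacked, $\mathbf{m}_i\in\mathbb{R}^{nk}$) have the joint prior distribution $$(\mathbf{m}_*,\mathbf{m})\sim N_{nk(l+1)}(0,\mathbf{K}_{l+1}\otimes\mathbf{I}_{nk}),\qquad \mathbf{K}_{l+1}=\begin{bmatrix}1&\mathbf{k}_l^T\\ \mathbf{k}_l&\mathbf{K}_l\end{bmatrix},$$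 so that the conditional distribution of $\mathbf{m}_*$ given $\mathbf{m}$ is $$\mathbf{m}_*\,|\,\mathbf{m}\sim N_{nk}\Big(\sum_{i=1}^l[\mathbf{K}_l^{-1}\mathbf{k}_l]_i\,\mathbf{m}_i,\ (1-\mathbf{k}_l^T\mathbf{K}_l^{-1}\mathbf{k}_l)\,\mathbf{I}_{nk}\Big).$$ (2) Likelihood. Let $\mathbf{x}_i=\mathrm{vec}(\mathbf{X}_i)$ and $[\mathbf{x}_i]=\{\mathrm{vec}(\mathbf{X}_i\mathbf{A}):\mathbf{A}\in\mathrm{GL}_k\}$, where $\mathrm{GL}_k$ is the group of invertible real $k\times k$ matrices. The likelihood is $L(\mathbf{m}_i\,|\,\mathfrak{X}_i)=1(\mathbf{m}_i\in[\mathbf{x}_i])$ (indicator function). (3) Posterior. The posterior distribution of $\mathbf{m}$ given $\mathfrak{X}$ has density $$p(\mathbf{m}\,|\,\mathfrak{X})\propto\exp\Big\{-\tfrac12\mathbf{m}^T(\mathbf{K}_l\otimes\mathbf{I}_{nk})^{-1}\mathbf{m}\Big\}\prod_{i=1}^l1(\mathbf{m}_i\in[\mathbf{x}_i])$$ with respect to Lebesgue measure on the linear subspace $S=\prod_{i=1}^l\{\mathrm{vec}(\mathbf{X}_i\mathbf{A}):\mathbf{A}\in\mathbb{R}^{k\times k}\}$ of $\mathbb{R}^{nkl}$ (of which $\prod_i[\mathbf{x}_i]$ is a full-measure subset). (4) Predictive distribution. The predictive distribution of $\mathbf{m}_*$ given $\mathfrak{X}$ is the mixture of the conditional distributions of $\mathbf{m}_*$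 given $\mathbf{m}$ in (1) over the posterior distribution of $\mathbf{m}$ in (3), that is, $p(\mathbf{m}_*\,|\,\mathfrak{X})=\int_S p(\mathbf{m}_*\,|\,\mathbf{m})\,p(\mathbf{m}\,|\,\mathfrak{X})\,d\mathbf{m}$. *)

(* Defs.v *)
From HB Require Import structures.
From mathcomp Require Import all_boot all_order all_algebra.
From mathcomp Require Export mxtens.
From mathcomp Require Import all_classical all_reals all_analysis.

Set Implicit Arguments.
Unset Strict Implicit.
Unset Printing Implicit Defensive.
Import Order.TTheory GRing.Theory Num.Theory.
Import numFieldNormedType.Exports.
Local Open Scope classical_set_scope.
Local Open Scope ring_scope.

Arguments mxtens_index {m n}.
Arguments mxtens_unindex {m n}.

Notation "A *t B" := (tensmx A B)
  (at level 40, left associativity, format "A  *t  B") : ring_scope.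

(* The index set of R^(p q) is 'I_(p * q), read through [mxtens_index] as the
   pairs (block number, position in the block) in lexicographic order; this is
   the order used by the Kronecker product [tensmx] (notation [*t]). *)
Section linear_algebra.
Context {R : realType}.

Definition vec n k (A : 'M[R]_(n, k)) : 'cV[R]_(k * n) :=
  \col_i A (mxtens_unindex i).2 (mxtens_unindex i).1.

Definition blk p q (m : 'cV[R]_(p * q)) (i : 'I_p) : 'cV[R]_q :=
  \col_j m (mxtens_index (i, j)) ord0.

Definition hcat l n k (X : 'I_l -> 'M[R]_(n, k)) : 'M[R]_(n, l * k) :=
  \matrix_(a, j) X (mxtens_unindex j).1 a (mxtens_unindex j).2.

Definition blkdiag l n k (X : 'I_l -> 'M[R]_(n, k)) : 'M[R]_(l * n, l * k) :=
  \matrix_(i, j) if (mxtens_unindex i).1 == (mxtens_unindex j).1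
    then X (mxtens_unindex i).1 (mxtens_unindex i).2 (mxtens_unindex j).2
    else 0.

Definition psd m (C : 'M[R]_m) : Prop :=
  C^T = C /\ forall a : 'cV[R]_m, 0 <= (a^T *m C *m a) ord0 ord0.

(* Only the restriction of [kf] to Theta x Theta matters. *)
Definition correlation_function (T : Type) (Theta : set T) (kf : T -> T -> R)
    : Prop :=
  [/\ forall x y, Theta x -> Theta y -> kf x y = kf y x,
      forall N (t : 'I_N -> T), (forall i, Theta (t i)) ->
        psd (\matrix_(i, j) kf (t i) (t j)) &
      forall x, Theta x -> kf x x = 1].

End linear_algebra.

(* Borel sigma-algebra of R^m, generated by the coordinates. *)
Section borel_cV.
Context {R : realType} (m : nat).

Definition cV_display : measure_display. Proof. exact: default_measure_display. Qed.

Let coords : 'I_m -> 'cV[R]_m -> measurableTypeR R := fun i x => x i ord0.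

Let cV_set0 : g_sigma_preimage coords set0.
Proof. exact: sigma_algebra0. Qed.

Let cV_setC A : g_sigma_preimage coords A -> g_sigma_preimage coords (~` A).
Proof. exact: sigma_algebraC. Qed.

Let cV_bigcup (F : _^nat) : (forall i, g_sigma_preimage coords (F i)) ->
  g_sigma_preimage coords (\bigcup_i (F i)).
Proof. exact: sigma_algebra_bigcup. Qed.

HB.instance Definition _ := @isMeasurable.Build cV_display
  'cV[R]_m (g_sigma_preimage coords) cV_set0 cV_setC cV_bigcup.

End borel_cV.

Section measures.
Context {R : realType}.

Fixpoint lebesgue_cV (m : nat) : set 'cV[R]_m -> \bar R :=
  match m with
  | 0%N => @dirac _ 'cV[R]_0 0 R
  | m'.+1 => pushforward (lebesgue_measure \x @lebesgue_cV m')%E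
      (fun p : measurableTypeR R * 'cV[R]_m' =>
         col_mx (const_mx p.1 : 'cV[R]_1) p.2 : 'cV[R]_m'.+1)
  end.

Definition orthonormal_basis m (S : set 'cV[R]_m) r (B : 'M[R]_(m, r)) : Prop :=
  B^T *m B = 1%:M /\ S = range (fun u : 'cV[R]_r => B *m u).

(* Lebesgue measure on a linear subspace S of R^m, seen as a measure on R^m:
   the image of Lebesgue measure on R^r under the coordinate map of an
   orthonormal basis of S; the basis is chosen, and by rotation invariance the
   result does not depend on the choice. *)
Definition subspace_lebesgue m (S : set 'cV[R]_m) : set 'cV[R]_m -> \bar R :=
  let B := xget (existT (fun r => 'M[R]_(m, r)) 0%N 0)
    [set B : {r : nat & 'M[R]_(m, r)} | orthonormal_basis S (projT2 B)] in
  pushforward (@lebesgue_cV (projT1 B)) (fun u => projT2 B *m u).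

(* N(mu, v) on the line, where v is the variance: the library's [normal_prob]
   is parametrized by the standard deviation and is not a Dirac mass when the
   latter is 0. *)
Definition normal1 (mu v : R) : set (measurableTypeR R) -> \bar R :=
  if v == 0 then @dirac _ (measurableTypeR R) mu R
  else normal_prob mu (Num.sqrt v).

(* P is the (possibly singular) Gaussian distribution N_m(mu, C): C is a
   covariance matrix, P is a probability measure on R^m, and every linear form
   x |-> a^T x has the law N(a^T mu, a^T C a) under P. *)
Definition gaussian_dist m (mu : 'cV[R]_m) (C : 'M[R]_m)
    (P : set 'cV[R]_m -> \bar R) : Prop :=
  psd C /\
  exists2 Q : probability 'cV[R]_m R,
    (forall A, measurable A -> P A = Q A) &
    forall (a : 'cV[R]_m) (B : set (measurableTypeR R)), measurable B ->
      pushforward Q (fun x => (a^T *m x) ord0 ord0 : measurableTypeR R) B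
      = normal1 ((a^T *m mu) ord0 ord0) ((a^T *m C *m a) ord0 ord0) B.

End measures.

Section model.
Context {R : realType} {n k l : nat}.
Variables (K : 'M[R]_l) (kl : 'cV[R]_l) (X : 'I_l -> 'M[R]_(n, k)).

Definition eps2 : R := 1 - (kl^T *m invmx K *m kl) ord0 ord0.

Definition prior_cov : 'M[R]_((1 + l) * (k * n)) :=
  block_mx (1%:M : 'M[R]_1) kl^T kl K *t (1%:M : 'M[R]_(k * n)).

Definition cond_mean (m : 'cV[R]_(l * (k * n))) : 'cV[R]_(k * n) :=
  \sum_(i < l) (invmx K *m kl) i ord0 *: blk m i.

(* A vector w of R^(nk(l+1)) is (m_*, m). *)
Definition mstar (w : 'cV[R]_((1 + l) * (k * n))) : 'cV[R]_(k * n) :=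
  blk w (lshift l ord0).

Definition mobs (w : 'cV[R]_((1 + l) * (k * n))) : 'cV[R]_(l * (k * n)) :=
  \col_i w (mxtens_index (rshift 1 (mxtens_unindex i).1, (mxtens_unindex i).2))
    ord0.

(* [J] is the joint prior distribution of (m_*, m) and [cond] the conditional
   distribution of m_* given m. The defining property of the latter determines
   it only up to null sets, and the posterior lives on a null set, so the
   Gaussian version is imposed at every m. *)
Definition gpsr_prior (J : probability 'cV[R]_((1 + l) * (k * n)) R)
    (cond : R.-pker 'cV[R]_(l * (k * n)) ~> 'cV[R]_(k * n)) : Prop :=
  [/\ gaussian_dist 0 prior_cov J,
      forall A B, measurable A -> measurable B ->
        J (mstar @^-1` A `&` mobs @^-1` B) =
        (\int[pushforward J mobs]_(m in B) cond m A)%E &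
      forall m, gaussian_dist (cond_mean m) (eps2%:M) (cond m)].

(* This set depends on Y only through its column span, so the likelihood is a
   function of the observed subspace. *)
Definition orbit_vec (Y : 'M[R]_(n, k)) : set 'cV[R]_(k * n) :=
  [set vec (Y *m A) | A in [set A : 'M[R]_k | A \in unitmx]].

Definition likelihood (Y : 'M[R]_(n, k)) (mi : 'cV[R]_(k * n)) : R :=
  \1_(orbit_vec Y) mi.

Definition obs_subspace : set 'cV[R]_(l * (k * n)) :=
  [set m | forall i, exists A : 'M[R]_k, blk m i = vec (X i *m A)].

Definition posterior_weight (m : 'cV[R]_(l * (k * n))) : R :=
  expR (- 2^-1 *
    (m^T *m invmx (K *t (1%:M : 'M[R]_(k * n))) *m m) ord0 ord0)
  * \prod_(i < l) likelihood (X i) (blk m i).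

Definition posterior_density (m : 'cV[R]_(l * (k * n))) : R :=
  posterior_weight m /
  fine (\int[subspace_lebesgue obs_subspace]_(m' in obs_subspace)
          (posterior_weight m')%:E)%E.

Definition predictive (cond : R.-pker 'cV[R]_(l * (k * n)) ~> 'cV[R]_(k * n))
    (A : set 'cV[R]_(k * n)) : \bar R :=
  (\int[subspace_lebesgue obs_subspace]_(m in obs_subspace)
     (cond m A * (posterior_density m)%:E))%E.

End model.

Lemma sum_mxtens {R : realType} p q (F : 'I_(p * q) -> R) :
  \sum_i F i = \sum_(i < p) \sum_(j < q) F (mxtens_index (i, j)).
Proof.
rewrite pair_bigA (reindex (@mxtens_index p q)) /=.
  by apply: eq_bigr => -[].
by exists mxtens_unindex => j _; [exact: mxtens_indexK|exact: mxtens_unindexK].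
Qed.

Lemma vec_mulmx {R : realType} n k (Y : 'M[R]_(n, k)) (A : 'M[R]_k) :
  vec (Y *m A) = ((1%:M : 'M[R]_k) *t Y) *m vec A.
Proof.
apply/colP => i; rewrite !mxE sum_mxtens.
rewrite [RHS](bigD1 (mxtens_unindex i).1)//= [X in _ = _ + X]big1 ?addr0.
  by apply: eq_bigr => c _; rewrite !mxE mxtens_indexK /= eqxx mul1r.
move=> j ji; apply: big1 => c _.
by rewrite !mxE mxtens_indexK /= eq_sym (negbTE ji) !mul0r.
Qed.

Lemma blk_blkdiag {R : realType} l n k (X : 'I_l -> 'M[R]_(n, k))
    (u : 'cV[R]_(l * k)) i : blk (blkdiag X *m u) i = X i *m blk u i.
Proof.
apply/colP => a; rewrite !mxE sum_mxtens.
rewrite [LHS](bigD1 i)//= [X in _ + X = _]big1 ?addr0.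
  by apply: eq_bigr => c _; rewrite !mxE !mxtens_indexK /= eqxx.
move=> j ji; apply: big1 => c _.
by rewrite !mxE !mxtens_indexK /= eq_sym (negbTE ji) mul0r.
Qed.

Lemma blk_inj {R : realType} p q (m m' : 'cV[R]_(p * q)) :
  (forall i, blk m i = blk m' i) -> m = m'.
Proof.
move=> mm'; apply/colP => a; case: (mxtens_indexP a) => i j.
by have /colP/(_ j) := mm' i; rewrite !mxE.
Qed.

(* Hence [subspace_lebesgue] is not its default value on this subspace. *)
Lemma obs_subspace_basis {R : realType} n k l (X : 'I_l -> 'M[R]_(n, k)) :
  (forall i, (X i)^T *m X i = 1%:M) ->
  orthonormal_basis (obs_subspace X)
    (blkdiag (fun i => (1%:M : 'M[R]_k) *t X i)).
Proof.
move=> Xo; split.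
  apply/matrixP => p q; rewrite !mxE sum_mxtens.
  set Z := fun i => (1%:M : 'M[R]_k) *t X i.
  case: (mxtens_indexP p) => p1 p2; case: (mxtens_indexP q) => q1 q2 /=.
  rewrite [LHS](bigD1 p1)//= [X in _ + X = _]big1 ?addr0; last first.
    move=> j jp; apply: big1 => c _.
    by rewrite !mxE !mxtens_indexK /= (negbTE jp) mul0r.
  rewrite (can_eq (@mxtens_indexK l (k * k))) xpair_eqE.
  have [<-|pq] := eqVneq p1 q1; last first.
    by apply: big1 => c _; rewrite !mxE !mxtens_indexK /= (negbTE pq) mulr0.
  transitivity ((((Z p1)^T *m Z p1)) p2 q2).
    by rewrite !mxE; apply: eq_bigr => c _; rewrite !mxE !mxtens_indexK /= eqxx.
  rewrite /Z trmx_tens tensmx_mul trmx1 mul1mx Xo.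
  case: (mxtens_indexP p2) => a b; case: (mxtens_indexP q2) => c e.
  rewrite tensmxE !mxE (can_eq (@mxtens_indexK k k)) xpair_eqE /=.
  by case: (a == c); case: (b == e); rewrite ?mulr1 ?mulr0.
apply/seteqP; split=> [m /= /choice[A mA]|_ [u _ <-] i].
  exists (\col_p vec (A (mxtens_unindex p).1) (mxtens_unindex p).2 ord0) => //.
  apply: blk_inj => i; rewrite blk_blkdiag mA vec_mulmx; congr (_ *m _).
  by apply/colP => b; rewrite [LHS]mxE [LHS]mxE mxtens_indexK.
rewrite blk_blkdiag.
exists (\matrix_(a, b) blk u i (mxtens_index (b, a)) ord0).
rewrite vec_mulmx; congr (_ *m _); apply/colP => b.
by case: (mxtens_indexP b) => b1 b2; rewrite [RHS]mxE [RHS]mxE mxtens_indexK.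
Qed.

(* Main.v *)
From HB Require Import structures.
Require Import Defs.
From mathcomp Require Import all_boot all_order all_algebra.
From mathcomp Require Import all_classical all_reals all_analysis.
From mathcomp Require Import measurable_realfun ring lra.

(** A linear form [a^T m_star] is, given [m], normal with mean
    [a^T cond_mean m] and variance [eps2 * a^T a].  The predictive distribution
    mixes these laws over the posterior of [m], so the theorem says that each
    such mixture is a centered normal law with the announced variance.

    Write [m = B *m u] with the columns of [B] an orthonormal basis of the
    observed subspace.  The likelihood is 1 almost everywhere
    ([singular_null]), so the posterior of [u] is proportional to
    [exp (- u^T Q u / 2)] with [Q = B^T M B] positive definite and [M] the
    inverse prior covariance ([integral_posterior_weight]).  The mean
    [a^T cond_mean (B *m u)] is a linear form [c^T u], and mixing normal laws
    whose mean is a linear form of a Gaussian vector gives the normal law of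
    variance [eps2 * a^T a + c^T Q^-1 c] ([gaussian_marginal]).  This is proved
    by integrating out one coordinate at a time: on the line it is the
    completion of a square ([normal1_gauss_weight]), and each step replaces [Q]
    by the Schur complement of its corner ([posdef_schur]).

    It remains to compute [c^T Q^-1 c] ([predictive_variance]).  Solving
    [Q h = c] amounts to a least squares problem on the observed subspace.  It
    decouples over the [k] columns of the matrix with vectorization [a]; after
    the blocks are rescaled by the weights [v], the normal equations have the
    matrix [XX^T (Kt *t 1) XX], whence the term
    [hcat X (XX^T (Kt *t 1) XX)^-1 (hcat X)^T] of Sigma.

    Describing Gaussian laws by their linear forms treats singular covariances,
    including [eps2 = 0], together with regular ones. *)

Set Implicit Arguments.
Unset Strict Implicit.
Unset Printing Implicit Defensive.
Import Order.TTheory GRing.Theory Num.Theory.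
Import numFieldNormedType.Exports.
Local Open Scope classical_set_scope.
Local Open Scope ring_scope.

(** * Affine changes of variable on the line *)

Section line.
Context {R : realType}.
Notation mu := (@lebesgue_measure R).

Let measurable_affine (c t : R) : measurable_fun [set: measurableTypeR R]
  (fun x : measurableTypeR R => c * x + t : measurableTypeR R).
Proof.
by apply: measurable_funD => //; apply: measurable_funM.
Qed.

(** Both sides are measures in [A]; on intervals the identity is arithmetic,
    and a measure that gives intervals their length is Lebesgue measure. *)
Lemma lebesgue_affine (c t : R) (A : set (measurableTypeR R)) :
  c != 0 -> measurable A ->
  (mu A = `|c|%:E * mu ((fun x : R => (c * x + t)%R) @^-1` A))%E.
Proof.
move=> c0 mA.
pose F0 : {measure set (measurableTypeR R) -> \bar R} :=
  pushforward mu (fun x : measurableTypeR R => c * x + t : measurableTypeR R).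
pose F := F0 (measurable_affine c t).
have c_ge0 : 0 <= `|c| by [].
have := @lebesgue_measure_unique R (mscale (NngNum c_ge0) F).
apply => //.
move=> _ [[a b] _ <-] /=.
rewrite /mscale /pushforward /=.
have [cp|cn|/eqP] := ltrgt0P c; last by rewrite (negbTE c0).
- rewrite [X in _ = (_ * mu X)%E](_ : _ = `](a-t)/c, (b-t)/c]%classic); last first.
    apply/seteqP; split=> x /=; rewrite !in_itv/= ltr_pdivrMr// ler_pdivlMr// mulrC.
    by case/andP=> *; apply/andP; split; lra.
    by case/andP=> *; apply/andP; split; lra.
  rewrite !lebesgue_measure_itv/= !lte_fin ltr_pM2r ?invr_gt0// ltrD2r.
  case: ifP => ab; last by rewrite mule0.
  rewrite -!EFinB -EFinM; congr EFin; field; lra.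
- rewrite [X in _ = (_ * mu X)%E](_ : _ = `[(b-t)/c, (a-t)/c[%classic); last first.
    apply/seteqP; split=> x /=; rewrite !in_itv/= ltr_ndivlMr// ler_ndivrMr// mulrC.
    by case/andP=> *; apply/andP; split; lra.
    by case/andP=> *; apply/andP; split; lra.
  rewrite !lebesgue_measure_itv/= !lte_fin ltr_nM2r ?invr_lt0// ltrD2r.
  case: ifP => ab; last by rewrite mule0.
  rewrite -!EFinB -EFinM; congr EFin; field; lra.
Qed.

Lemma integral_affine (c t : R) (f : R -> \bar R) : c != 0 ->
  measurable_fun setT f -> (forall x, 0 <= f x)%E ->
  (\int[mu]_x f x = `|c|%:E * \int[mu]_x f (c * x + t)%R)%E.
Proof.
move=> c0 mf f0.
pose F0 : {measure set (measurableTypeR R) -> \bar R} :=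
  pushforward mu (fun x : measurableTypeR R => c * x + t : measurableTypeR R).
pose F := F0 (measurable_affine c t).
have c_ge0 : 0 <= `|c| by [].
rewrite (@eq_measure_integral _ _ _ _ (mscale (NngNum c_ge0) F)); last first.
  move=> A mA _; exact: lebesgue_affine.
rewrite ge0_integral_mscale//; congr (_ * _)%E.
rewrite ge0_integral_pushforward//.
Qed.

End line.

(** * Normal laws on the line *)

Section normal.
Context {R : realType}.
Notation mu := (@lebesgue_measure R).
Implicit Types (m v q t s c x y : R) (A : set (measurableTypeR R)).

Lemma normal_pdf_sqrt m v x : 0 < v ->
  normal_pdf m (Num.sqrt v) x =
  (Num.sqrt (2 * pi * v))^-1 * expR (- (2^-1 * ((x - m) ^+ 2 / v))).
Proof.
move=> v0; rewrite normal_pdfE ?gt_eqF ?sqrtr_gt0// /normal_peak /normal_fun.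
rewrite sqr_sqrtr ?ltW//; congr ((Num.sqrt _)^-1 * expR _).
  by rewrite -mulr_natr; ring.
by rewrite -mulr_natr; field; lra.
Qed.

Lemma measurable_gauss_weight q m :
  measurable_fun setT (fun x : R => expR (- (2^-1 * (q * (x - m) ^+ 2)))).
Proof.
apply: measurableT_comp => //; apply: measurableT_comp => //.
do 2 (apply: measurable_funM => //).
by apply: measurable_funX; apply: measurable_funB.
Qed.

Lemma integral_gauss_weight q m : 0 < q ->
  (\int[mu]_x (expR (- (2^-1 * (q * (x - m) ^+ 2))))%:E
   = (Num.sqrt (2 * pi / q))%:E)%E.
Proof.
move=> q0; have z0 : 0 < Num.sqrt (2 * pi / q).
  by rewrite sqrtr_gt0 divr_gt0// mulr_gt0// pi_gt0.
rewrite -[RHS]mule1 -(integral_normal_pdf m (Num.sqrt q^-1)).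
rewrite -ge0_integralZl//.
- apply: eq_integral => x _; rewrite normal_pdf_sqrt ?invr_gt0// -EFinM.
  by congr EFin; rewrite [RHS]mulrA mulfV ?gt_eqF// mul1r invrK (mulrC q).
- by apply/measurable_EFinP; exact: measurable_normal_pdf.
- by move=> x _; rewrite lee_fin normal_pdf_ge0.
Qed.

Lemma normal1_ge0 m v A : (0 <= normal1 m v A)%E.
Proof. by rewrite /normal1; case: ifP => _; exact: measure_ge0. Qed.

Lemma normal1_setT m v : normal1 m v setT = 1%E.
Proof.
rewrite /normal1; case: ifP => _; first by rewrite diracT.
exact: probability_setT.
Qed.

Lemma normal1_gtE m v A : 0 < v -> measurable A ->
  normal1 m v A = (\int[mu]_x ((\1_A x)%:E *
    ((Num.sqrt (2 * pi * v))^-1 * expR (- (2^-1 * ((x - m) ^+ 2 / v))))%:E))%E.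
Proof.
move=> v0 mA; rewrite /normal1 gt_eqF// /normal_prob integral_mkcond.
apply: eq_integral => x _; rewrite -normal_pdf_sqrt// patchE indicE.
by case: ifP; rewrite ?mul1e ?mul0e.
Qed.

Let measurable_kernel1 m v A : measurable A -> measurable_fun setT
  (fun x : measurableTypeR R => ((\1_A x)%:E *
    ((Num.sqrt (2 * pi * v))^-1 * expR (- (2^-1 * ((x - m) ^+ 2 / v))))%:E)%E).
Proof.
move=> mA; apply: emeasurable_funM.
  by apply/measurable_EFinP; exact: measurable_indic.
apply/measurable_EFinP; apply: measurable_funM => //.
have := @measurable_gauss_weight v^-1 m; congr measurable_fun.
by apply/funext => x; congr (expR (- (_ * _))); rewrite mulrC.
Qed.

Let measurable_pdf2 v :
  measurable_fun setT (fun p : measurableTypeR R * measurableTypeR R =>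
  (Num.sqrt (2 * pi * v))^-1 * expR (- (2^-1 * ((p.2 - p.1) ^+ 2 / v)))).
Proof.
apply: measurable_funM => //.
apply: measurableT_comp => //; apply: measurableT_comp => //.
apply: measurable_funM => //; apply: measurable_funM => //.
by apply: measurable_funX; apply: measurable_funB.
Qed.

Lemma measurable_normal1 v A : 0 <= v -> measurable A ->
  measurable_fun setT (fun m : measurableTypeR R => normal1 m v A).
Proof.
rewrite le_eqVlt => /predU1P[<-|v0] mA.
  rewrite /normal1 eqxx /dirac /=.
  by apply/measurable_EFinP; exact: measurable_indic.
under eq_fun => m do rewrite normal1_gtE//.
apply: (measurable_fun_fubini_tonelli_F
  (fun p : measurableTypeR R * measurableTypeR R => ((\1_A p.2)%:E *
     ((Num.sqrt (2 * pi * v))^-1 *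
       expR (- (2^-1 * ((p.2 - p.1) ^+ 2 / v))))%:E)%E)).
  apply: emeasurable_funM; last by apply/measurable_EFinP; exact: measurable_pdf2.
  by apply/measurable_EFinP; apply: measurableT_comp => //; exact: measurable_indic.
by move=> p; rewrite mule_ge0// lee_fin// mulr_ge0// ?expR_ge0// invr_ge0 sqrtr_ge0.
Qed.

(** Completing the square in [x]: the left side is the exponent of a normal
    density in [y] whose mean depends affinely on a normal [x]; on the right,
    [y] has its marginal variance [D] and [x] its conditional law given [y]. *)
Let complete_square q c s t x y : 0 < q -> 0 < s ->
  let D := s + c ^+ 2 / q in
  (y - (c * x + t)) ^+ 2 / s + q * x ^+ 2 =
  (y - t) ^+ 2 / D + (q * D / s) * (x - c * (y - t) / (q * D)) ^+ 2.
Proof.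
move=> q0 s0 D; rewrite /D.
have h : s * q + c ^+ 2 != 0 by rewrite gt_eqF// ltr_wpDr ?sqr_ge0// mulr_gt0.
by field; rewrite h !gt_eqF.
Qed.

(** Mixing the laws [N(c x + t, s)] over a centered normal [x] of variance
    [1 / q], here with unnormalized density, gives [N(t, s + c ^+ 2 / q)].  For [s > 0] one exchanges the two
    integrals and uses [complete_square]; for [s = 0] the mixed laws are Dirac
    masses and the identity is the change of variable [y = c x + t]. *)
Lemma normal1_gauss_weight q c t s A : 0 < q -> 0 <= s -> measurable A ->
  (\int[mu]_x (normal1 (c * x + t)%R s A * (expR (- (2^-1 * (q * x ^+ 2))))%:E)
   = (Num.sqrt (2 * pi / q))%:E * normal1 t (s + c ^+ 2 / q) A)%E.
Proof.
move=> q0 s_ge0 mA.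
have mG : measurable_fun setT (fun x : R => expR (- (2^-1 * (q * x ^+ 2)))).
  have := @measurable_gauss_weight q 0; congr measurable_fun.
  by apply/funext => x; rewrite subr0.
have IG : (\int[mu]_x (expR (- (2^-1 * (q * x ^+ 2))))%:E
   = (Num.sqrt (2 * pi / q))%:E)%E.
  by rewrite -(integral_gauss_weight 0 q0); apply: eq_integral => x _; rewrite subr0.
have [->|c0] := eqVneq c 0.
  under eq_integral do rewrite mul0r add0r.
  rewrite expr0n/= mul0r addr0 ge0_integralZl ?normal1_ge0//.
  - by rewrite IG muleC.
  - exact/measurable_EFinP.
have cq0 : 0 < c ^+ 2 / q by rewrite divr_gt0// exprn_even_gt0//= c0.
move: s_ge0; rewrite le_eqVlt => /predU1P[<-|s0].
  rewrite add0r normal1_gtE// [in RHS](@integral_affine _ c t _ c0)/=; last 2 first.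
  - apply: emeasurable_funM; first by apply/measurable_EFinP; exact: measurable_indic.
    apply/measurable_EFinP; apply: measurable_funM => //.
    have := @measurable_gauss_weight (c ^+ 2 / q)^-1 t; congr measurable_fun.
    by apply/funext => x; congr (expR (- (_ * _))); rewrite mulrC.
  - move=> x; apply: mule_ge0; rewrite lee_fin//.
  rewrite muleA -ge0_integralZl//.
  - apply: eq_integral => x _; rewrite /normal1 eqxx diracE.
    rewrite muleCA -EFinM indicE -!EFinM; congr EFin; congr (_ * _).
    have -> : (c * x + t - t) ^+ 2 / (c ^+ 2 / q) = q * x ^+ 2.
      by field; rewrite c0 gt_eqF.
    rewrite [RHS]mulrA -[LHS]mul1r; congr (_ * _).
    rewrite -sqrtr_sqr -sqrtrM ?divr_ge0 ?mulr_ge0 ?pi_ge0 ?ltW//.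
    rewrite (_ : 2 * pi / q * c ^+ 2 = 2 * pi * (c ^+ 2 / q)); last by ring.
    by rewrite mulfV// gt_eqF// sqrtr_gt0 (mulr_gt0 _ cq0)// mulr_gt0 ?pi_gt0.
  - apply: (@measurableT_comp _ _ _ _ _ _ _ _ _
      (measurable_kernel1 t (c ^+ 2 / q) mA)).
    by apply: measurable_funD => //; apply: measurable_funM.
set D := s + c ^+ 2 / q.
have D0 : 0 < D by rewrite addr_gt0.
pose g (p : measurableTypeR R * measurableTypeR R) : \bar R :=
  ((\1_A p.2)%:E * ((Num.sqrt (2 * pi * s))^-1 *
    (expR (- (2^-1 * ((p.2 - (c * p.1 + t)) ^+ 2 / s))) *
     expR (- (2^-1 * (q * p.1 ^+ 2)))))%:E)%E.
have g0 p : (0 <= g p)%E.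
  by rewrite mule_ge0// lee_fin// !mulr_ge0 ?expR_ge0// invr_ge0 sqrtr_ge0.
have mg : measurable_fun setT g.
  apply: emeasurable_funM.
    by apply/measurable_EFinP; apply: measurableT_comp => //; exact: measurable_indic.
  apply/measurable_EFinP; apply: measurable_funM => //; apply: measurable_funM.
    apply: measurableT_comp => //; apply: measurableT_comp => //.
    apply: measurable_funM => //; apply: measurable_funM => //.
    apply: measurable_funX; apply: measurable_funB => //.
    by apply: measurable_funD => //; apply: measurable_funM.
  by apply: (measurableT_comp mG).
transitivity (\int[mu]_x \int[mu]_y g (x, y))%E.
  apply: eq_integral => x _; rewrite normal1_gtE//.
  rewrite -ge0_integralZr//.
  - apply: eq_integral => y _; rewrite /g /= -!EFinM; congr EFin.
    by rewrite -!mulrA.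
  - exact: measurable_kernel1.
rewrite (@fubini_tonelli _ _ _ _ _ mu mu g mg g0)/= normal1_gtE//.
rewrite -ge0_integralZl//; last first.
  exact: measurable_kernel1.
apply: eq_integral => y _.
transitivity (\int[mu]_x (((\1_A y)%:E * ((Num.sqrt (2 * pi * s))^-1 *
    expR (- (2^-1 * ((y - t) ^+ 2 / D))))%:E) *
    (expR (- (2^-1 *
       ((q * D / s) * (x - c * (y - t) / (q * D)) ^+ 2))))%:E)%E)%E.
  apply: eq_integral => x _; rewrite /g /= -[in RHS]muleA; congr (_ * _)%E.
  rewrite -[in RHS]EFinM; congr EFin; rewrite -[RHS]mulrA; congr (_ * _).
  by rewrite -!expRD -!opprD -!mulrDr complete_square.
rewrite ge0_integralZl//; last first.
  by apply/measurable_EFinP; exact: measurable_gauss_weight.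
rewrite integral_gauss_weight; last by rewrite divr_gt0// mulr_gt0.
rewrite -[LHS]muleA [RHS]muleCA; congr (_ * _)%E; rewrite -!EFinM; congr EFin.
rewrite [LHS]mulrAC [RHS]mulrA; congr (_ * _).
have p0 := pi_gt0 R.
rewrite -!sqrtrV ?mulr_ge0 ?ltW// -!sqrtrM ?invr_ge0 ?divr_ge0 ?mulr_ge0 ?ltW//.
congr Num.sqrt; move: (pi : R) p0 => p p0; field; rewrite !gt_eqF//.
Qed.

End normal.

(** * Lebesgue measure on column vectors *)

Section borel_vectors.
Context {R : realType}.

Lemma measurable_coord m (i : 'I_m) :
  measurable_fun setT (fun x : 'cV[R]_m => x i ord0 : measurableTypeR R).
Proof.
move=> _ A mA; rewrite setTI; apply: sub_sigma_algebra.
case: m i => [[]//|m i]; rewrite -bigcup_mkord_ord.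
exists (nat_of_ord i); first exact: ltn_ord.
exists A => //.
by rewrite setTI inord_val.
Qed.

Lemma measurable_fun_cV d (T : measurableType d) m (f : T -> 'cV[R]_m) :
  (forall i, measurable_fun setT (fun x => f x i ord0 : measurableTypeR R)) ->
  measurable_fun setT f.
Proof.
move=> mf; apply: (@measurability _ _ _ _ _ _
  (\big[setU/set0]_(i < m) preimage_set_system setT
     (fun x : 'cV[R]_m => x i ord0 : measurableTypeR R) measurable)).
  by [].
move=> _ [A + <-]; rewrite setTI.
elim/big_ind : _ => //.
  by move=> S1 S2 h1 h2 [/h1|/h2].
move=> i _ [B mB <-]; rewrite setTI.
by have := mf i measurableT B mB; rewrite setTI.
Qed.

Lemma measurable_mulmx d (T : measurableType d) m p (B : 'M[R]_(p, m))
    (f : T -> 'cV[R]_m) :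
  measurable_fun setT f -> measurable_fun setT (fun x => B *m f x).
Proof.
move=> mf; apply: measurable_fun_cV => i.
under eq_fun => x do rewrite mxE.
apply: measurable_sum => j; apply: measurable_funM => //.
exact: measurableT_comp (measurable_coord j) mf.
Qed.

Lemma measurable_cVD d (T : measurableType d) m (f g : T -> 'cV[R]_m) :
  measurable_fun setT f -> measurable_fun setT g ->
  measurable_fun setT (fun x => f x + g x).
Proof.
move=> mf mg; apply: measurable_fun_cV => i.
under eq_fun => x do rewrite mxE.
apply: measurable_funD; [exact: measurableT_comp (measurable_coord i) mf|
  exact: measurableT_comp (measurable_coord i) mg].
Qed.

Definition consv m (p : measurableTypeR R * 'cV[R]_m) : 'cV[R]_m.+1 :=
  col_mx (const_mx p.1 : 'cV[R]_1) p.2.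

Lemma consv0 m p : @consv m p ord0 ord0 = p.1.
Proof.
by rewrite /consv mxE; case: splitP => j // _; rewrite mxE.
Qed.

Lemma consvS m p i : @consv m p (lift ord0 i) ord0 = p.2 i ord0.
Proof.
rewrite /consv mxE; case: splitP => j /=; first by rewrite (ord1 j).
by case=> ij; congr (p.2 _ _); exact: val_inj.
Qed.

Lemma measurable_consv m : measurable_fun setT (@consv m).
Proof.
apply: measurable_fun_cV => i; case: (unliftP ord0 i) => [j|] ->.
  under eq_fun => x do rewrite consvS.
  exact: measurableT_comp (measurable_coord j) measurable_snd.
under eq_fun => x do rewrite consv0.
exact: measurable_fst.
Qed.

Definition unconsv m (x : 'cV[R]_m.+1) : measurableTypeR R * 'cV[R]_m :=
  (x ord0 ord0, \col_i x (lift ord0 i) ord0).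

Lemma measurable_unconsv m : measurable_fun setT (@unconsv m).
Proof.
apply/measurable_fun_pairP; split; first exact: measurable_coord.
apply: measurable_fun_cV => i.
under eq_fun => x do rewrite mxE.
exact: measurable_coord.
Qed.

Lemma consvK m : cancel (@consv m) (@unconsv m).
Proof.
move=> [a x]; rewrite /unconsv consv0; congr pair.
by apply/colP => i; rewrite mxE consvS.
Qed.

Lemma unconsvK m : cancel (@unconsv m) (@consv m).
Proof.
move=> x; apply/colP => i; case: (unliftP ord0 i) => [j|] ->.
  by rewrite consvS mxE.
by rewrite consv0.
Qed.

(** Sigma-finiteness is part of the induction: it is what makes the next
    product with the line a measure, and what Tonelli's theorem requires. *)
Lemma lebesgue_cV_measure m :
  exists mu : {sigma_finite_measure set 'cV[R]_m -> \bar R},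
    @lebesgue_cV R m = mu :> (set 'cV[R]_m -> \bar R).
Proof.
elim: m => [|m [mu IH]]; first by exists (@dirac _ 'cV[R]_0 0 R).
pose P : {measure set (measurableTypeR R * 'cV[R]_m)%type -> \bar R} :=
  (lebesgue_measure \x mu)%E.
pose F0 : {measure set 'cV[R]_m.+1 -> \bar R} := pushforward P (@consv m).
pose F := F0 (@measurable_consv m).
have sfF : sigma_finite setT F.
  have /sigma_finiteP[G [TG ndG Goo]] := sigma_finiteT (@lebesgue_measure R).
  have /sigma_finiteP[H [TH ndH Hoo]] := sigma_finiteT mu.
  exists (fun n => @unconsv m @^-1` (G n `*` H n)).
    apply/seteqP; split=> // x _.
    have [i _ Gi] : (\bigcup_i G i) (unconsv x).1 by rewrite -TG.
    have [j _ Hj] : (\bigcup_i H i) (unconsv x).2 by rewrite -TH.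
    exists (maxn i j) => //; split.
    - by move: Gi; apply/subsetPset/ndG/leq_maxl.
    - by move: Hj; apply/subsetPset/ndH/leq_maxr.
  move=> i; have [mG Gi] := Goo i; have [mH Hi] := Hoo i; split.
    rewrite -[X in measurable X]setTI; apply: measurable_unconsv => //.
    exact: measurableX.
  rewrite [F _](_ : _ = P (G i `*` H i)).
    by rewrite [P _]product_measure1E// lte_mul_pinfty// ge0_fin_numE.
  by congr (P _); apply/funext => x; rewrite /preimage /mkset consvK.
pose S := Measure_isSigmaFinite.Build _ _ _ F sfF.
pose F' : {sigma_finite_measure set 'cV[R]_m.+1 -> \bar R} :=
  HB.pack (F : set 'cV[R]_m.+1 -> \bar R) (Measure.class F) S.
by exists F'; rewrite /= IH.
Qed.

(** [lebesgue_cV] together with the structure of a sigma-finite measure, so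
    that the theory of integration applies to it. *)
Definition leb m := sval (cid (lebesgue_cV_measure m)).

Lemma lebE m : @lebesgue_cV R m = leb m :> (set 'cV[R]_m -> \bar R).
Proof. by rewrite /leb; case: cid. Qed.

Lemma integral_leb0 (f : 'cV[R]_0 -> \bar R) : (forall x, 0 <= f x)%E ->
  measurable_fun setT f -> (\int[leb 0]_x f x = f 0%R)%E.
Proof. by move=> f0 mf; rewrite -lebE /= integral_dirac// diracT mul1e. Qed.

Lemma integral_lebS m (f : 'cV[R]_m.+1 -> \bar R) : (forall x, 0 <= f x)%E ->
  measurable_fun setT f ->
  (\int[leb m.+1]_x f x =
   \int[leb m]_y \int[lebesgue_measure]_a f (consv (a, y)))%E.
Proof.
move=> f0 mf; rewrite -lebE /= lebE -/(@consv m).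
rewrite (ge0_integral_pushforward (@measurable_consv m))//=.
rewrite preimage_setT (@fubini_tonelli2 _ _ _ _ _ lebesgue_measure (leb m))//.
exact: measurableT_comp (@measurable_consv m).
Qed.

End borel_vectors.

(** * Translation invariance and null sets *)

Section translation.
Context {R : realType}.

Lemma consvD m a y (h : 'cV[R]_m.+1) :
  consv (a, y) + h = consv (a + (unconsv h).1, y + (unconsv h).2).
Proof.
apply/colP => i; rewrite mxE; case: (unliftP ord0 i) => [j|] ->.
  by rewrite !consvS !mxE.
by rewrite !consv0.
Qed.

Lemma integral_leb_shift m (f : 'cV[R]_m -> \bar R) (h : 'cV[R]_m) :
  (forall x, 0 <= f x)%E -> measurable_fun setT f ->
  (\int[leb m]_u f (u + h)%R = \int[leb m]_u f u)%E.
Proof.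
elim: m f h => [|m IH] f h f0 mf.
  by congr integral; apply/funext => x; congr f; rewrite [LHS]flatmx0 [RHS]flatmx0.
have mD (k : 'cV[R]_m.+1) : measurable_fun setT (fun u : 'cV[R]_m.+1 => u + k).
  exact: measurable_cVD.
rewrite !integral_lebS//; last exact: measurableT_comp mf (mD h).
have mfc : measurable_fun setT (f \o @consv R m).
  exact: measurableT_comp mf (@measurable_consv R m).
rewrite -[RHS](IH _ (unconsv h).2)//; first last.
- exact: (measurable_fun_fubini_tonelli_G (f \o @consv R m) mfc (fun=> f0 _)).
- by move=> y; apply: integral_ge0.
apply: eq_integral => y _.
rewrite [RHS](@integral_affine _ 1 (unconsv h).1)//; last first.
  by apply: measurableT_comp mfc _ => /=; exact: pair2_measurable.
rewrite normr1 mul1e; apply: eq_integral => a _.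
by rewrite consvD mul1r.
Qed.

(** By translation invariance, the integral over [t] of the measure of
    [N - t *: e] is the measure of [N] times infinity.  By Tonelli's theorem it
    is also the integral over [u] of the length of [N] along the line through
    [u], which vanishes.  So a null set is recognized without any change of
    coordinates that would make [e] a coordinate axis. *)
Lemma leb_null_lines m (N : set 'cV[R]_m) (e : 'cV[R]_m) : measurable N ->
  (forall u, countable [set t | N (u + t *: e)]) -> leb m N = 0%E.
Proof.
move=> mN cN.
pose g (p : measurableTypeR R * 'cV[R]_m) : \bar R := (\1_N (p.2 + p.1 *: e)%R)%:E.
have g0 p : (0 <= g p)%E by rewrite lee_fin.
have mline : measurable_fun setT
    (fun p : measurableTypeR R * 'cV[R]_m => p.2 + p.1 *: e).
  apply: measurable_cVD; first exact: measurable_snd.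
  apply: measurable_fun_cV => i; under eq_fun => p do rewrite mxE.
  by apply: measurable_funM.
have mg : measurable_fun setT g.
  apply/measurable_EFinP; apply: measurableT_comp mline.
  exact: measurable_indic.
have := @fubini_tonelli _ _ _ _ _ (@lebesgue_measure R) (leb m) g mg g0.
rewrite [RHS]integral0_eq; last first.
  move=> u _; rewrite /g/= -[RHS](@countable_lebesgue_measure0 R _ (cN u)).
  rewrite -[X in lebesgue_measure X]setIT -integral_indic//.
  rewrite -[X in measurable X]setTI.
  exact: (measurableT_comp mline (@pair2_measurable _ _ _ _ u)).
have -> : (\int[lebesgue_measure]_x \int[leb m]_y g (x, y) =
           \int[@lebesgue_measure R]_x (cst (leb m N) x))%E.
  apply: eq_integral => t _; rewrite /g/=.
  rewrite (@integral_leb_shift _ (fun u => (\1_N u)%:E) (t *: e))//.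
    by rewrite integral_indic// setIT.
  by apply/measurable_EFinP; exact: measurable_indic.
have lT : lebesgue_measure [set: measurableTypeR R] = +oo%E.
  by rewrite -[X in lebesgue_measure X]set_itvNyy lebesgue_measure_itv.
rewrite integral_cst// [X in (_ * X)%E]lT.
by move/eqP; rewrite mule_eq0 orbF => /eqP.
Qed.

End translation.


(** * Gaussian integrals over column vectors *)

Section gaussian.
Context {R : realType}.

Definition dotv m (x y : 'cV[R]_m) : R := (x^T *m y) ord0 ord0.

Definition quadf m (Q : 'M[R]_m) (x : 'cV[R]_m) : R := (x^T *m Q *m x) ord0 ord0.

Definition posdef m (Q : 'M[R]_m) : Prop :=
  Q^T = Q /\ forall x : 'cV[R]_m, x != 0 -> 0 < quadf Q x.

Lemma dotvE m (x y : 'cV[R]_m) : dotv x y = \sum_i x i ord0 * y i ord0.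
Proof. by rewrite /dotv mxE; apply: eq_bigr => i _; rewrite mxE. Qed.

Lemma posdef_quadf_ge0 m (Q : 'M[R]_m) x : posdef Q -> 0 <= quadf Q x.
Proof.
move=> [_ Q0]; have [->|/Q0/ltW//] := eqVneq x 0.
by rewrite /quadf mulmx0 mxE.
Qed.

Lemma dotvC m (x y : 'cV[R]_m) : dotv x y = dotv y x.
Proof. by rewrite /dotv -[in LHS](trmxK (x^T *m y)) [LHS]mxE trmx_mul trmxK. Qed.

Lemma dotvDr m (x y z : 'cV[R]_m) : dotv x (y + z) = dotv x y + dotv x z.
Proof. by rewrite /dotv mulmxDr mxE. Qed.

Lemma dotvZr m a (x y : 'cV[R]_m) : dotv x (a *: y) = a * dotv x y.
Proof. by rewrite /dotv -scalemxAr mxE. Qed.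

Lemma dotvNr m (x y : 'cV[R]_m) : dotv x (- y) = - dotv x y.
Proof. by rewrite /dotv mulmxN mxE. Qed.

Lemma dotvDl m (x y z : 'cV[R]_m) : dotv (x + y) z = dotv x z + dotv y z.
Proof. by rewrite dotvC dotvDr !(dotvC z). Qed.

Lemma dotvZl m a (x y : 'cV[R]_m) : dotv (a *: x) y = a * dotv x y.
Proof. by rewrite dotvC dotvZr (dotvC y). Qed.

Lemma dotvNl m (x y : 'cV[R]_m) : dotv (- x) y = - dotv x y.
Proof. by rewrite dotvC dotvNr dotvC. Qed.

Lemma quadfE m (Q : 'M[R]_m) x : quadf Q x = dotv x (Q *m x).
Proof. by rewrite /quadf /dotv mulmxA. Qed.

Lemma dotv_ge0 m (x : 'cV[R]_m) : 0 <= dotv x x.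
Proof. by rewrite dotvE sumr_ge0// => i _; exact: sqr_ge0. Qed.

Lemma quadf_scalar m (c : R) (a : 'cV[R]_m) : quadf c%:M a = c * dotv a a.
Proof. by rewrite quadfE mul_scalar_mx dotvZr. Qed.

Lemma quadfD m (S1 S2 : 'M[R]_m) a : quadf (S1 + S2) a = quadf S1 a + quadf S2 a.
Proof. by rewrite !quadfE mulmxDl dotvDr. Qed.

Lemma dotv_mul_outer m (b x : 'cV[R]_m) : b *m b^T *m x = dotv b x *: b.
Proof.
by rewrite -mulmxA [b^T *m x]mx11_scalar mul_mx_scalar.
Qed.

Lemma dotv_consv m a b (x y : 'cV[R]_m) :
  dotv (consv (a, x)) (consv (b, y)) = a * b + dotv x y.
Proof.
rewrite !dotvE big_ord_recl !consv0; congr (_ + _).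
by apply: eq_bigr => i _; rewrite !consvS.
Qed.

Lemma mul_block_consv m (q : R) (b : 'cV[R]_m) (Q : 'M[R]_m) a y :
  (block_mx q%:M b^T b Q : 'M[R]_m.+1) *m consv (a, y) =
  consv (q * a + dotv b y, a *: b + Q *m y).
Proof.
rewrite /consv (@mul_block_col _ 1 m 1 m 1)/=.
rewrite (_ : b *m const_mx a = a *: b); last first.
  by apply/matrixP => i j; rewrite !ord1 !mxE big_ord1 !mxE mulrC.
rewrite (_ : q%:M *m const_mx a + b^T *m y = const_mx (q * a + dotv b y))//.
apply/matrixP => i j; rewrite !ord1 mul_scalar_mx /dotv [LHS]mxE [RHS]mxE.
by congr (_ + _); rewrite !mxE.
Qed.

Lemma quadf_consv m (q : R) (b : 'cV[R]_m) (Q : 'M[R]_m) a y :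
  quadf (block_mx q%:M b^T b Q : 'M[R]_m.+1) (consv (a, y)) =
  q * a ^+ 2 + 2 * a * dotv b y + quadf Q y.
Proof.
rewrite /quadf -mulmxA mul_block_consv -/(dotv _ _) dotv_consv dotvDr dotvZr.
by rewrite (dotvC y) /dotv mulmxA; ring.
Qed.

(** [consv] is [col_mx] with a scalar head, so the matching decomposition of a
    symmetric matrix isolates its first row and column. *)
Lemma sym_blockE m (Q : 'M[R]_m.+1) : Q^T = Q ->
  exists q (b : 'cV[R]_m) (Q' : 'M[R]_m), Q = block_mx q%:M b^T b Q' /\ Q'^T = Q'.
Proof.
move=> Qs; exists (Q ord0 ord0); exists (dlsubmx (Q : 'M[R]_(1 + m))).
exists (drsubmx (Q : 'M[R]_(1 + m))).
split; last by rewrite trmx_drsub Qs.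
have -> : (Q ord0 ord0)%:M = ulsubmx (Q : 'M[R]_(1 + m)).
  by rewrite [RHS]mx11_scalar !mxE; congr (Q _ _)%:M; exact: val_inj.
rewrite (trmx_dlsub (Q : 'M[R]_(1 + m))) Qs.
by symmetry; exact: (@submxK _ 1 m 1 m).
Qed.

Lemma consv_eq0 m a (y : 'cV[R]_m) : (consv (a, y) == 0) = (a == 0) && (y == 0).
Proof.
apply/eqP/andP => [h|[/eqP-> /eqP->]].
  have := consvK (a, y); rewrite h /unconsv mxE => -[<- <-]; split => //.
  by apply/eqP/colP => i; rewrite !mxE.
by apply/colP => i; case: (unliftP ord0 i) => [j|] ->; rewrite ?consvS ?consv0 !mxE.
Qed.

(** The Schur complement of the corner [q] is the quadratic form in [y] that
    remains after minimizing over the first coordinate [a], the minimum being at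
    [a = - dotv b y / q]. *)
Lemma posdef_schur m (q : R) (b : 'cV[R]_m) (Q : 'M[R]_m) : Q^T = Q ->
  posdef (block_mx q%:M b^T b Q : 'M[R]_m.+1) ->
  0 < q /\ posdef (Q - q^-1 *: (b *m b^T)).
Proof.
move=> Qs [_ Q0].
have q0 : 0 < q.
  have := Q0 (consv (1, 0)); rewrite consv_eq0 oner_eq0/= => /(_ isT).
  rewrite quadf_consv quadfE /dotv !mulmx0 !mxE expr1n mulr1 mulr0 !addr0.
  by [].
split => //; split => [|y y0].
  by rewrite linearB linearZ/= trmx_mul trmxK Qs.
have := Q0 (consv (- (dotv b y / q), y)).
rewrite consv_eq0 (negbTE y0) andbF => /(_ isT); rewrite quadf_consv !quadfE.
rewrite mulmxBl -scalemxAl dotv_mul_outer dotvDr dotvNr !dotvZr (dotvC y b).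
congr (_ < _); field; exact: lt0r_neq0.
Qed.

Lemma measurable_dotv d (T : measurableType d) m (c : 'cV[R]_m) (f : T -> 'cV[R]_m) :
  measurable_fun setT f -> measurable_fun setT (fun x => dotv c (f x)).
Proof.
move=> mf; rewrite /dotv.
exact: measurableT_comp (measurable_coord ord0) (measurable_mulmx c^T mf).
Qed.

Lemma measurable_quadf m (Q : 'M[R]_m) : measurable_fun setT (quadf Q).
Proof.
rewrite (_ : quadf Q = fun x => \sum_i x i ord0 * (Q *m x) i ord0); last first.
  by apply/funext => x; rewrite quadfE dotvE.
apply: measurable_sum => i; apply: measurable_funM; first exact: measurable_coord.
apply: measurableT_comp (measurable_coord i) _.
exact: measurable_mulmx (@measurable_id _ _ _).
Qed.

Definition gauss_weight m (Q : 'M[R]_m) (x : 'cV[R]_m) : R :=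
  expR (- (2^-1 * quadf Q x)).

Lemma measurable_gauss_weight_cV m (Q : 'M[R]_m) :
  measurable_fun setT (gauss_weight Q).
Proof.
apply: measurableT_comp => //; apply: measurableT_comp => //.
by apply: measurable_funM => //; exact: measurable_quadf.
Qed.

Lemma marginal_integrand_ge0 m (Q : 'M[R]_m) c t s A u :
  (0 <= normal1 (dotv c u + t)%R s A * (gauss_weight Q u)%:E)%E.
Proof. by rewrite mule_ge0 ?normal1_ge0// lee_fin expR_ge0. Qed.

Lemma measurable_marginal_integrand m (Q : 'M[R]_m) c t s A :
  0 <= s -> measurable A -> measurable_fun setT
    (fun u => normal1 (dotv c u + t)%R s A * (gauss_weight Q u)%:E)%E.
Proof.
move=> s0 mA; apply: emeasurable_funM; last first.
  by apply/measurable_EFinP; exact: measurable_gauss_weight_cV.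
apply: (measurableT_comp (measurable_normal1 s0 mA)).
by apply: measurable_funD => //; exact: measurable_dotv.
Qed.

(** The linear form [dotv c u] of a vector [u] with density proportional to
    [gauss_weight Q] is centered normal with variance [dotv c (invmx Q *m c)].
    The variance is written with a solution [h] of [Q *m h = c], which spares the
    inverse.  The law [N(dotv c u + t, s)] is mixed in because this form is
    stable under induction on the dimension: integrating out the first
    coordinate by [normal1_gauss_weight] replaces [Q] by its Schur complement
    and adds [c0 ^+ 2 / q] to [s].  One constant [Z] serves all linear forms, so
    it is also the total mass of [gauss_weight Q]. *)
Lemma gaussian_marginal m (Q : 'M[R]_m) : posdef Q -> exists2 Z : R, 0 < Z &
  forall (c h : 'cV[R]_m) (t s : R) (A : set (measurableTypeR R)),
  Q *m h = c -> 0 <= s -> measurable A ->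
  (\int[leb m]_u (normal1 (dotv c u + t)%R s A * (gauss_weight Q u)%:E)
   = Z%:E * normal1 t (s + dotv c h) A)%E.
Proof.
elim: m Q => [|m IH] Q Qpd.
  exists 1 => // c h t s A Qh s0 mA.
  rewrite integral_leb0.
  - rewrite /gauss_weight quadfE !dotvE !big_ord0 mulr0 oppr0 expR0 mule1 mul1e.
    by rewrite add0r addr0.
  - by move=> x; exact: marginal_integrand_ge0.
  - exact: measurable_marginal_integrand.
have [q [b [Q' [QE Q's]]]] := sym_blockE Qpd.1.
rewrite QE in Qpd *.
have [q0 Spd] := posdef_schur Q's Qpd.
have [Z Z0 HZ] := IH _ Spd.
exists (Num.sqrt (2 * pi / q) * Z).
  by rewrite mulr_gt0// sqrtr_gt0 divr_gt0// mulr_gt0// pi_gt0.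
move=> c h t s A Qh s0 mA.
rewrite -(unconsvK c) -(unconsvK h) in Qh *.
move: (unconsv c) (unconsv h) Qh => [c0 c'] [h0 h'] {c h}.
rewrite mul_block_consv => /(congr1 (@unconsv R m)); rewrite !consvK => -[hc0 hc'].
rewrite integral_lebS; last 2 first.
  - by move=> x; exact: marginal_integrand_ge0.
  - exact: measurable_marginal_integrand.
(* the linear form that remains when the first coordinate, shifted by its
   conditional mean - dotv b y / q, is integrated out *)
pose c'' := c' - (c0 / q) *: b.
have c0q : 0 <= c0 ^+ 2 / q by rewrite divr_ge0 ?sqr_ge0// ltW.
transitivity (\int[leb m]_y ((Num.sqrt (2 * pi / q))%:E *
   (normal1 (dotv c'' y + t)%R (s + c0 ^+ 2 / q)%R A *
    (gauss_weight (Q' - q^-1 *: (b *m b^T)) y)%:E)))%E.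
  apply: eq_integral => y _.
  have mg : measurable_fun setT (fun a : R =>
      normal1 (c0 * a + (dotv c'' y + t))%R s A *
      (expR (- (2^-1 * (q * a ^+ 2))))%:E)%E.
    apply: emeasurable_funM.
      apply: (measurableT_comp (measurable_normal1 s0 mA)).
      by apply: measurable_funD => //; apply: measurable_funM.
    apply/measurable_EFinP; have := @measurable_gauss_weight R q 0.
    by congr measurable_fun; apply/funext => x; rewrite subr0.
  rewrite [RHS]muleA -normal1_gauss_weight// -ge0_integralZr//; last 2 first.
  - by move=> x _; rewrite mule_ge0 ?normal1_ge0// lee_fin expR_ge0.
  - by rewrite lee_fin expR_ge0.
  rewrite [RHS](@integral_affine _ 1 (dotv b y / q))//; last 2 first.
  - exact: emeasurable_funM.
  - by move=> x; rewrite !mule_ge0 ?normal1_ge0// lee_fin expR_ge0.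
  rewrite normr1 mul1e; apply: eq_integral => a _.
  rewrite -muleA -EFinM /gauss_weight -expRD; congr (normal1 _ _ _ * (expR _)%:E)%E.
    rewrite dotv_consv /c'' dotvDl dotvNl dotvZl; field; exact: lt0r_neq0.
  rewrite quadf_consv !quadfE mulmxBl -scalemxAl dotv_mul_outer dotvDr dotvNr.
  rewrite !dotvZr (dotvC y b); field; exact: lt0r_neq0.
rewrite ge0_integralZl//; last 2 first.
- by apply: measurable_marginal_integrand => //; rewrite addr_ge0.
- by move=> u _; exact: marginal_integrand_ge0.
rewrite (HZ c'' h')//; last 2 first.
  - rewrite mulmxBl -scalemxAl dotv_mul_outer scalerA /c'' -hc' -hc0.
    rewrite (_ : _ / q = h0 + q^-1 * dotv b h'); last first.
      by field; exact: lt0r_neq0.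
    by rewrite scalerDl opprD addrACA subrr add0r.
  - by rewrite addr_ge0.
rewrite muleA -EFinM; congr (_ * normal1 _ _ _)%E.
rewrite dotv_consv -addrA; congr (_ + _).
rewrite /c'' dotvDl dotvNl dotvZl -hc0; field; exact: lt0r_neq0.
Qed.

End gaussian.

(** * Positive definite matrices *)

Section posdef.
Context {R : realType}.

Lemma dotv_eq0 m (x : 'cV[R]_m) : dotv x x = 0 -> x = 0.
Proof.
rewrite dotvE => /eqP; rewrite psumr_eq0 => [/allP h|i _]; last exact: sqr_ge0.
apply/colP => i; rewrite mxE; apply/eqP; rewrite -sqrf_eq0 expr2.
by have := h i; rewrite mem_index_enum => /(_ isT).
Qed.

Lemma dotv_trmx m p (B : 'M[R]_(m, p)) x y : dotv x (B *m y) = dotv (B^T *m x) y.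
Proof. by rewrite /dotv trmx_mul trmxK mulmxA. Qed.

Lemma dotv0r m (x : 'cV[R]_m) : dotv x 0 = 0.
Proof. by rewrite /dotv mulmx0 mxE. Qed.

Lemma dotv_sumr m I (r : seq I) (P : pred I) (x : 'cV[R]_m) F :
  dotv x (\sum_(i <- r | P i) F i) = \sum_(i <- r | P i) dotv x (F i).
Proof. exact: (big_morph _ (dotvDr x) (dotv0r x)). Qed.

Lemma posdef_unitmx m (Q : 'M[R]_m) : posdef Q -> Q \in unitmx.
Proof.
move=> [Qs Q0]; rewrite unitmxE unitfE; apply/det0P => -[u u0 uQ].
have := Q0 u^T; rewrite -(inj_eq trmx_inj) trmxK trmx0 => /(_ u0).
by rewrite /quadf trmxK uQ mul0mx mxE ltxx.
Qed.

Lemma posdef_congr m p (Q : 'M[R]_m) (B : 'M[R]_(m, p)) : posdef Q ->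
  (forall u : 'cV_p, B *m u = 0 -> u = 0) -> posdef (B^T *m Q *m B).
Proof.
move=> [Qs Q0] Binj; split; first by rewrite !trmx_mul trmxK Qs mulmxA.
move=> x x0; have := Q0 (B *m x); rewrite /quadf trmx_mul !mulmxA; apply.
by apply: contraNneq x0 => /Binj ->.
Qed.

Lemma posdef_invmx m (Q : 'M[R]_m) : posdef Q -> posdef (invmx Q).
Proof.
move=> Qpd; have Qu := posdef_unitmx Qpd.
have Qis : (invmx Q)^T = invmx Q by rewrite trmx_inv Qpd.1.
have := @posdef_congr _ _ Q (invmx Q) Qpd; rewrite Qis mulVmx// mul1mx; apply.
by move=> u /(congr1 (mulmx Q)); rewrite mulmxA mulmxV// mul1mx mulmx0.
Qed.

(** If the form vanishes at [x], it must stay nonnegative at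
    [x + t *: (Q *m x)] for all [t], which forces [Q *m x = 0]. *)
Lemma psd_unitmx_posdef m (Q : 'M[R]_m) : psd Q -> Q \in unitmx -> posdef Q.
Proof.
move=> [Qs Q0] Qu; split=> // x x0; rewrite lt_neqAle [X in _ && X]Q0 andbT.
apply: contraNneq x0 => /esym xQx.
pose z := Q *m x; pose b := quadf Q z.
have b0 : 0 <= b := Q0 z.
have key t : 0 <= 2 * t * dotv z z + t ^+ 2 * b.
  have := Q0 (x + t *: z); rewrite -/(quadf _ _) quadfE mulmxDr -scalemxAr.
  rewrite dotvDr !dotvDl !dotvZr !dotvZl -!quadfE xQx -/z -/b.
  rewrite [dotv x (Q *m z)]dotv_trmx Qs -/z.
  by congr (_ <= _); ring.
have zz : dotv z z = 0.
  have b1 : 0 < b + 1 by rewrite ltr_wpDl.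
  (* adding 1 avoids the case b = 0; the value of the polynomial is negative
     there unless dotv z z = 0 *)
  have := key (- dotv z z / (b + 1)).
  have -> : 2 * (- dotv z z / (b + 1)) * dotv z z + (- dotv z z / (b + 1)) ^+ 2 * b
     = - (dotv z z ^+ 2 * ((b + 2) / (b + 1) ^+ 2)).
    by field; exact: lt0r_neq0.
  rewrite oppr_ge0 => h; apply/eqP; rewrite -sqrf_eq0 eq_le sqr_ge0 andbT.
  rewrite -(@pmulr_lle0 _ ((b + 2) / (b + 1) ^+ 2))//.
  by rewrite divr_gt0// ?exprn_gt0// ltr_wpDl.
move/dotv_eq0 : zz => /(congr1 (mulmx (invmx Q))).
by rewrite mulmxA mulVmx// mul1mx mulmx0 => /eqP.
Qed.

End posdef.

(** * Vectors read by blocks *)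

Section blocks.
Context {R : realType}.

Lemma blkE p q (m : 'cV[R]_(p * q)) i j :
  blk m i j ord0 = m (mxtens_index (i, j)) ord0.
Proof. by rewrite mxE. Qed.

Lemma dotv_blk p q (x y : 'cV[R]_(p * q)) :
  dotv x y = \sum_i dotv (blk x i) (blk y i).
Proof.
rewrite dotvE sum_mxtens; apply: eq_bigr => i _; rewrite dotvE.
by apply: eq_bigr => j _; rewrite !blkE.
Qed.

Lemma blk_tens1mx p q r (S : 'M[R]_(r, q)) (x : 'cV[R]_(p * q)) i :
  blk (((1%:M : 'M[R]_p) *t S) *m x) i = S *m blk x i.
Proof.
apply/colP => j; rewrite !mxE sum_mxtens (bigD1 i)//= [X in _ + X]big1 ?addr0.
  by apply: eq_bigr => c _; rewrite blkE tensmxE !mxE eqxx mul1r.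
move=> i' i'i; apply: big1 => c _.
by rewrite tensmxE !mxE eq_sym (negbTE i'i) !mul0r.
Qed.

Lemma quadf_tens1mx p q (S : 'M[R]_q) (a : 'cV[R]_(p * q)) :
  quadf ((1%:M : 'M[R]_p) *t S) a = \sum_j quadf S (blk a j).
Proof.
by rewrite quadfE dotv_blk; apply: eq_bigr => i _; rewrite blk_tens1mx -quadfE.
Qed.

Lemma psd_tens1mx p q (S : 'M[R]_q) : S^T = S -> (forall a, 0 <= quadf S a) ->
  psd ((1%:M : 'M[R]_p) *t S).
Proof.
move=> Ss S0; split; first by rewrite trmx_tens trmx1 Ss.
by move=> a; rewrite -/(quadf _ _) quadf_tens1mx sumr_ge0.
Qed.

Lemma blk_tensmx1 p q (K : 'M[R]_p) (x : 'cV[R]_(p * q)) i :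
  blk ((K *t (1%:M : 'M[R]_q)) *m x) i = \sum_j K i j *: blk x j.
Proof.
apply/colP => j; rewrite summxE mxE mxE sum_mxtens; apply: eq_bigr => i' _.
rewrite (bigD1 j)//= [X in _ + X]big1 ?addr0.
  by rewrite tensmxE !mxE eqxx mulr1.
by move=> c cj; rewrite tensmxE !mxE eq_sym (negbTE cj) mulr0 mul0r.
Qed.

(** The quadratic form of [K *t 1%:M] is the sum of those of [K] at the slices
    of the vector, one for each position inside the blocks. *)
Lemma posdef_tensmx1 p q (K : 'M[R]_p) : posdef K -> posdef (K *t (1%:M : 'M[R]_q)).
Proof.
move=> Kpd; split; first by rewrite trmx_tens trmx1 Kpd.1.
pose z (x : 'cV[R]_(p * q)) (j : 'I_q) : 'cV[R]_p :=
  \col_i x (mxtens_index (i, j)) ord0.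
have quadfz x : quadf (K *t (1%:M : 'M[R]_q)) x = \sum_j quadf K (z x j).
  rewrite quadfE dotv_blk.
  under eq_bigr => i _ do rewrite blk_tensmx1 dotvE.
  rewrite exchange_big/=; apply: eq_bigr => j _; rewrite quadfE dotvE.
  apply: eq_bigr => i _; rewrite !mxE summxE; congr (_ * _).
  by apply: eq_bigr => c _; rewrite !mxE.
move=> x x0; rewrite quadfz.
have [j zj] : exists j, z x j != 0.
  apply/existsP; apply: contraNT x0 => /existsPn h; apply/eqP/blk_inj => i.
  apply/colP => j; rewrite !mxE; have /negPn/eqP/colP/(_ i) := h j.
  by rewrite !mxE.
rewrite (bigD1 j)//= ltr_wpDr ?Kpd.2// sumr_ge0// => c _.
exact: posdef_quadf_ge0.
Qed.

Lemma blk_trmx_blkdiag l n k (X : 'I_l -> 'M[R]_(n, k)) (u : 'cV[R]_(l * n)) i :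
  blk ((blkdiag X)^T *m u) i = (X i)^T *m blk u i.
Proof.
rewrite -(blk_blkdiag (fun i => (X i)^T)); congr (blk (_ *m _) i).
apply/matrixP => p q; rewrite !mxE eq_sym.
by case: eqP => // ->.
Qed.

Lemma blk_trmx_hcat l n k (X : 'I_l -> 'M[R]_(n, k)) (a : 'cV[R]_n) i :
  blk ((hcat X)^T *m a) i = (X i)^T *m a.
Proof.
apply/colP => j; rewrite !mxE; apply: eq_bigr => c _.
by rewrite !mxE mxtens_indexK.
Qed.

Lemma hcat_mulmx l n k (X : 'I_l -> 'M[R]_(n, k)) (y : 'cV[R]_(l * k)) :
  hcat X *m y = \sum_i X i *m blk y i.
Proof.
apply/colP => j; rewrite summxE mxE sum_mxtens; apply: eq_bigr => i _.
by rewrite mxE; apply: eq_bigr => c _; rewrite !mxE mxtens_indexK.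
Qed.

Definition stackv p q (W : 'I_p -> 'cV[R]_q) : 'cV[R]_(p * q) :=
  \col_i W (mxtens_unindex i).1 (mxtens_unindex i).2 ord0.

Lemma blk_stackv p q (W : 'I_p -> 'cV[R]_q) i : blk (stackv W) i = W i.
Proof. by apply/colP => j; rewrite !mxE mxtens_indexK. Qed.

(** Blocks of blocks are the columns of the matrices, so membership in the
    observed subspace is a condition on each column separately. *)
Lemma obs_subspaceP n k l (X : 'I_l -> 'M[R]_(n, k)) m :
  obs_subspace X m <->
  forall i j, exists z : 'cV[R]_k, blk (blk m i) j = X i *m z.
Proof.
split=> [h i j|h i].
  have [A ->] := h i; exists (col j A); apply/colP => c.
  by rewrite !mxE mxtens_indexK; apply: eq_bigr => e _; rewrite mxE.
have /choice[Z hZ] := h i.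
exists (\matrix_(a, b) Z b a ord0); apply: blk_inj => j; rewrite hZ.
apply/colP => c; rewrite !mxE mxtens_indexK.
by apply: eq_bigr => e _; rewrite !mxE.
Qed.

End blocks.

(** * The covariance carried by the observed subspace *)

Section variance.
Context {R : realType}.

Lemma tensmx11 p q : (1%:M : 'M[R]_p) *t (1%:M : 'M[R]_q) = 1%:M.
Proof.
apply/matrixP => i j; case: (mxtens_indexP i) => a b; case: (mxtens_indexP j) => c e.
rewrite tensmxE !mxE (can_eq (@mxtens_indexK p q)) xpair_eqE /=.
by case: (a == c); case: (b == e); rewrite ?mulr1 ?mulr0.
Qed.

Lemma mulmx1_invmx m (A B : 'M[R]_m) : A *m B = 1%:M -> invmx A = B.
Proof.
move=> AB; have [Au _] := mulmx1_unit AB.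
by rewrite -[LHS]mulmx1 -AB mulmxA mulVmx// mul1mx.
Qed.

Lemma invmx_tensmx1 p q (K : 'M[R]_p) : K \in unitmx ->
  invmx (K *t (1%:M : 'M[R]_q)) = invmx K *t (1%:M : 'M[R]_q).
Proof.
by move=> Ku; apply: mulmx1_invmx; rewrite tensmx_mul mulmxV// mulmx1 tensmx11.
Qed.

Lemma orthonormal_inj m r (B : 'M[R]_(m, r)) (u : 'cV[R]_r) :
  B^T *m B = 1%:M -> B *m u = 0 -> u = 0.
Proof. by move=> BB /(congr1 (mulmx B^T)); rewrite mulmxA BB mul1mx mulmx0. Qed.

Lemma blkdiag_inj n k l (X : 'I_l -> 'M[R]_(n, k)) (u : 'cV[R]_(l * k)) :
  (forall i, (X i)^T *m X i = 1%:M) -> blkdiag X *m u = 0 -> u = 0.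
Proof.
move=> Xo Xu; apply: blk_inj => i; transitivity (0 : 'cV[R]_k); last first.
  by apply/colP => j; rewrite !mxE.
apply: (orthonormal_inj (Xo i)); rewrite -blk_blkdiag Xu.
by apply/colP => j; rewrite !mxE.
Qed.

Lemma blkB p q (x y : 'cV[R]_(p * q)) i : blk (x - y) i = blk x i - blk y i.
Proof. by apply/colP => j; rewrite !mxE. Qed.

Lemma blkZ p q a (x : 'cV[R]_(p * q)) i : blk (a *: x) i = a *: blk x i.
Proof. by apply/colP => j; rewrite !mxE. Qed.

Lemma blk_sum p q I (r : seq I) (F : I -> 'cV[R]_(p * q)) i :
  blk (\sum_(j <- r) F j) i = \sum_(j <- r) blk (F j) i.
Proof.
by apply/colP => c; rewrite mxE !summxE; apply: eq_bigr => j _; rewrite mxE.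
Qed.

Section variance_lemma.
Variables (n k l r : nat) (K : 'M[R]_l) (v : 'cV[R]_l) (X : 'I_l -> 'M[R]_(n, k)).
Variable B : 'M[R]_(l * (k * n), r).
Hypotheses (Kpd : posdef K) (v0 : forall i, v i ord0 != 0).
Hypothesis Xo : forall i, (X i)^T *m X i = 1%:M.
Hypothesis Bo : orthonormal_basis (obs_subspace X) B.

Let M := invmx (K *t (1%:M : 'M[R]_(k * n))).
Let Dv : 'M[R]_l := diag_mx v^T.
Let Kt := invmx (Dv *m K *m Dv).
Let W := (blkdiag X)^T *m (Kt *t (1%:M : 'M[R]_n)) *m blkdiag X.
Let P := hcat X *m invmx W *m (hcat X)^T.

Lemma diag_mulmxE (u : 'cV[R]_l) i : (Dv *m u) i ord0 = v i ord0 * u i ord0.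
Proof. by rewrite /Dv mul_diag_mx !mxE. Qed.

Lemma posdef_inv_scaled : posdef Kt.
Proof.
apply: posdef_invmx.
have -> : Dv *m K *m Dv = Dv^T *m K *m Dv by rewrite /Dv tr_diag_mx.
apply: posdef_congr => // u Du; apply/colP => i; apply/eqP.
move/colP/(_ i)/eqP: Du; rewrite diag_mulmxE !mxE mulf_eq0.
by rewrite (negbTE (v0 i)).
Qed.

Lemma invmx_scaledE i j : invmx K i j = v i ord0 * Kt i j * v j ord0.
Proof.
have Gu : Dv *m K *m Dv \in unitmx.
  by rewrite -unitmx_inv; exact: posdef_unitmx posdef_inv_scaled.
have : Dv *m (K *m Dv *m Kt) = 1%:M by rewrite !mulmxA mulmxV.
move/mulmx1C; rewrite -!mulmxA => /mulmx1_invmx ->.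
by rewrite mul_diag_mx mul_mx_diag !mxE mulrA.
Qed.

Lemma posdef_gram : posdef W.
Proof.
apply: posdef_congr; first exact/posdef_tensmx1/posdef_inv_scaled.
by move=> u; exact: blkdiag_inj.
Qed.

Lemma quadf_subspace_cov_ge0 a : 0 <= quadf P a.
Proof.
rewrite quadfE /P -!mulmxA dotv_trmx mulmxA.
rewrite -[X in dotv _ X]mulmxA -quadfE.
exact/posdef_quadf_ge0/posdef_invmx/posdef_gram.
Qed.

Lemma subspace_cov_sym : P^T = P.
Proof. by rewrite /P !trmx_mul trmxK trmx_inv posdef_gram.1 mulmxA. Qed.

(** Block [i] of the equation [W *m y = (hcat X)^T *m a]. *)
Lemma normal_equations (a : 'cV[R]_n) (y := invmx W *m (hcat X)^T *m a) i :
  (X i)^T *m (\sum_j Kt i j *: (X j *m blk y j)) = (X i)^T *m a.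
Proof.
rewrite -[RHS]blk_trmx_hcat.
have -> : (hcat X)^T *m a = W *m y.
  by rewrite /y !mulmxA mulmxV ?mul1mx//; exact: posdef_unitmx posdef_gram.
rewrite /W -!mulmxA blk_trmx_blkdiag blk_tensmx1; congr (_ *m _).
by apply: eq_bigr => j _; rewrite blk_blkdiag.
Qed.

(** [dotv (B^T *m g) u] is the conditional mean of [a^T m_star] at the point
    [B *m u] of the observed subspace, and its variance needs a solution [h] of
    [Q *m h = B^T *m g] with [Q = B^T *m M *m B].  Equivalently, one needs a
    point [w = B *m h] of the subspace such that [M *m w - g] is orthogonal to
    it.  That point is found column by column: its block [i] is [X i] applied to
    block [i] of the solution [y] of the normal equations, divided by [v i].
    The division turns the factor [invmx K] of [M] into [Kt], and it cancels
    the weights [v i] when the blocks of [w] are summed. *)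
Lemma predictive_variance (a : 'cV[R]_(k * n)) (g := stackv (fun i => v i ord0 *: a)) :
  exists h, (B^T *m M *m B) *m h = B^T *m g /\
    dotv (B^T *m g) h = \sum_j quadf P (blk a j).
Proof.
pose y j := invmx W *m (hcat X)^T *m blk a j.
pose w := stackv (fun i => stackv (fun j => (v i ord0)^-1 *: (X i *m blk (y j) i))).
have [h wBh] : exists h, B *m h = w.
  have : obs_subspace X w.
    apply/obs_subspaceP => i j; exists ((v i ord0)^-1 *: blk (y j) i).
    by rewrite !blk_stackv scalemxAr.
  by rewrite Bo.2 => -[h _ <-]; exists h.
exists h; split.
  rewrite -mulmxA wBh -mulmxA; apply/eqP; rewrite -subr_eq0 -mulmxBr; apply/eqP.
  apply: dotv_eq0; rewrite dotv_trmx trmxK.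
  set m := B *m _.
  have /obs_subspaceP mS : obs_subspace X m.
    by rewrite Bo.2; eexists.
  rewrite dotv_blk big1// => i _; rewrite dotv_blk big1// => j _.
  have XE : (X i)^T *m blk (blk (M *m w - g) i) j = 0.
    rewrite !blkB blk_stackv blkZ /M invmx_tensmx1 ?posdef_unitmx// blk_tensmx1.
    rewrite blk_sum.
    have -> : \sum_i' blk (invmx K i i' *: blk w i') j =
        v i ord0 *: (\sum_i' Kt i i' *: (X i' *m blk (y j) i')).
      rewrite scaler_sumr; apply: eq_bigr => i' _.
      rewrite blkZ !blk_stackv invmx_scaledE !scalerA; congr (_ *: _).
      by field; exact: v0.
    by rewrite -scalerBr -scalemxAr mulmxBr normal_equations subrr scaler0.
  by have [z ->] := mS i j; rewrite dotvC dotv_trmx XE dotvC dotv0r.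
rewrite -dotv_trmx wBh dotv_blk.
under eq_bigr => i _ do rewrite !blk_stackv dotv_blk.
rewrite exchange_big/=; apply: eq_bigr => j _.
rewrite quadfE /P -!mulmxA [invmx W *m _]mulmxA -/(y j).
rewrite hcat_mulmx dotv_sumr; apply: eq_bigr => i _.
by rewrite blkZ blk_stackv dotvZl dotvZr mulrA mulfV ?mul1r.
Qed.

End variance_lemma.

End variance.

(** * Singular coefficient matrices and measurability of the orbits *)

Section null.
Context {R : realType}.

Lemma det_addr_scalar k (A : 'M[R]_k) t : \det (A + t%:M) = (char_poly (- A)).[t].
Proof.
rewrite -horner_evalE /char_poly -det_map_mx; congr (\det _).
apply/matrixP => i j; rewrite !mxE rmorphB/= /horner_eval hornerC opprK addrC.
by congr (_ + _); case: (i == j); rewrite ?mulr1n ?mulr0n ?hornerX ?horner0.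
Qed.

Lemma roots_in_seq (p : {poly R}) : p != 0 ->
  exists s : seq R, forall t, root p t -> t \in s.
Proof.
move: {2}(size p) (leqnn (size p)) => n; elim: n p => [|n IH] p.
  by rewrite leqn0 size_poly_eq0 => ->.
move=> sp p0; have [[t rt]|nr] := pselect (exists t, root p t); last first.
  by exists [::] => t rt; exfalso; apply: nr; exists t.
have [q pE] := factor_theorem _ _ rt.
have q0 : q != 0 by apply: contraNneq p0 => q0; rewrite pE q0 mul0r.
have [|s hs] := IH q _ q0.
  by move: sp; rewrite pE size_Mmonic ?monicXsubC// size_XsubC addn2.
exists (t :: s) => u; rewrite pE rootM root_XsubC inE.
by case/orP => [/hs ->|->]; rewrite ?orbT.
Qed.

Lemma measurable_det d (T : measurableType d) k (F : T -> 'M[R]_k) :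
  (forall i j, measurable_fun setT (fun x => F x i j)) ->
  measurable_fun setT (fun x => \det (F x)).
Proof.
move=> mF; apply: measurable_sum => s; apply: measurable_funM => //.
by apply: measurable_prod => i _; exact: mF.
Qed.

Lemma measurable_ker m p (G : 'M[R]_(p, m)) :
  measurable [set x : 'cV[R]_m | G *m x = 0].
Proof.
have -> : [set x : 'cV[R]_m | G *m x = 0] = quadf (G^T *m G) @^-1` [set 0].
  apply/seteqP; split=> x /=.
    by rewrite quadfE -mulmxA => ->; rewrite !mulmx0 dotv0r.
  by rewrite quadfE -mulmxA dotv_trmx trmxK => /dotv_eq0.
rewrite -[X in measurable X]setTI; apply: measurable_quadf => //.
Qed.

Definition unvec n k (m : 'cV[R]_(k * n)) : 'M[R]_(n, k) :=
  \matrix_(a, b) m (mxtens_index (b, a)) ord0.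

Lemma vecK n k : cancel (@vec R n k) (@unvec n k).
Proof. by move=> A; apply/matrixP => a b; rewrite !mxE mxtens_indexK. Qed.

Lemma unvecK n k : cancel (@unvec n k) (@vec R n k).
Proof.
move=> m; apply/colP => i; case: (mxtens_indexP i) => a b.
by rewrite !mxE mxtens_indexK.
Qed.

Lemma blk_vec n k (A : 'M[R]_(n, k)) j : blk (vec A) j = col j A.
Proof. by apply/colP => i; rewrite !mxE mxtens_indexK. Qed.

Lemma vec_mulmx_rect p n k (Y : 'M[R]_(p, n)) (A : 'M[R]_(n, k)) :
  vec (Y *m A) = ((1%:M : 'M[R]_k) *t Y) *m vec A.
Proof.
apply: blk_inj => j; rewrite blk_tens1mx !blk_vec; apply/colP => i.
by rewrite !mxE; apply: eq_bigr => c _; rewrite !mxE.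
Qed.

(** Orthonormality recovers the coefficient matrix as [Y^T *m unvec m]; the
    orbit is thus cut out by a linear equation and a determinant, hence Borel. *)
Lemma orbit_vecE n k (Y : 'M[R]_(n, k)) : Y^T *m Y = 1%:M ->
  orbit_vec Y = [set m | (((1%:M : 'M[R]_k) *t (Y *m Y^T)) - 1%:M) *m m = 0]
    `&` [set m | \det (Y^T *m unvec m) != 0].
Proof.
move=> Yo; apply/seteqP; split=> [_ [A Au <-]|m [/= m1 m2]].
  split=> /=; last by rewrite vecK mulmxA Yo mul1mx -unitfE -unitmxE.
  apply/eqP; rewrite mulmxBl mul1mx subr_eq0; apply/eqP.
  by rewrite vec_mulmx mulmxA tensmx_mul mulmx1 -mulmxA Yo mulmx1.
exists (Y^T *m unvec m); first by rewrite /= unitmxE unitfE.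
move/eqP: m1; rewrite mulmxBl mul1mx subr_eq0 => /eqP m1.
by rewrite mulmxA vec_mulmx_rect unvecK.
Qed.

End null.

(** * The posterior in coordinates *)

Section posterior.
Context {R : realType}.
Variables (n k l : nat) (K : 'M[R]_l) (X : 'I_l -> 'M[R]_(n, k)).
Hypothesis Xo : forall i, (X i)^T *m X i = 1%:M.

Let M := invmx (K *t (1%:M : 'M[R]_(k * n))).

Lemma subspace_lebesgueE m (S : set 'cV[R]_m) r0 (B0 : 'M[R]_(m, r0)) :
  orthonormal_basis S B0 -> exists r (B : 'M[R]_(m, r)),
    orthonormal_basis S B /\
    subspace_lebesgue S = pushforward (leb r) (fun u => B *m u).
Proof.
move=> B0o; rewrite /subspace_lebesgue.
set x := xget _ _.
have : orthonormal_basis S (projT2 x).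
  apply: (@xgetPex _ _ [set B : {r : nat & 'M[R]_(m, r)} |
    orthonormal_basis S (projT2 B)]).
  by exists (existT (fun r => 'M[R]_(m, r)) r0 B0).
by move: x => [r B] /= Bo; exists r, B; rewrite lebE.
Qed.

Lemma measurable_obs_subspace : measurable (obs_subspace X).
Proof.
have [BB SE] := obs_subspace_basis Xo; set B := blkdiag _ in BB SE.
have -> : obs_subspace X = [set m | (B *m B^T - 1%:M) *m m = 0].
  rewrite SE; apply/seteqP; split=> [_ [u _ <-]|m] /=.
    by rewrite mulmxBl mul1mx mulmxA -(mulmxA B) BB mulmx1 subrr.
  move/eqP; rewrite mulmxBl mul1mx subr_eq0 -mulmxA => /eqP <-.
  by eexists.
exact: measurable_ker.
Qed.

Lemma measurable_blk p q (i : 'I_p) :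
  measurable_fun setT (fun m : 'cV[R]_(p * q) => blk m i).
Proof.
apply: measurable_fun_cV => j; under eq_fun => x do rewrite blkE.
exact: measurable_coord.
Qed.

Lemma measurable_orbit_vec (Y : 'M[R]_(n, k)) : Y^T *m Y = 1%:M ->
  measurable (orbit_vec Y).
Proof.
move=> Yo; rewrite orbit_vecE//; apply: measurableI; first exact: measurable_ker.
rewrite (_ : [set m | _] =
  (fun m => \det (Y^T *m unvec m)) @^-1` (~` [set 0])); last first.
  by apply/seteqP; split=> m /= /eqP.
rewrite -[X in measurable X]setTI.
apply: measurable_det => //; last exact: measurableC.
move=> i j; under eq_fun => m do rewrite mxE.
apply: measurable_sum => c; apply: measurable_funM => //.
by under eq_fun => m do rewrite mxE; exact: measurable_coord.
Qed.

Lemma posterior_weight_ge0 m : 0 <= posterior_weight K X m.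
Proof. by rewrite mulr_ge0 ?expR_ge0// prodr_ge0. Qed.

Lemma measurable_posterior_weight : measurable_fun setT (posterior_weight K X).
Proof.
apply: measurable_funM.
  by have := measurable_gauss_weight_cV M; congr measurable_fun; apply/funext => m;
    rewrite /gauss_weight mulNr.
apply: measurable_prod => i _.
have h := @measurable_indic _ _ R setT _ (measurable_orbit_vec (Xo i)).
exact: (measurableT_comp h (@measurable_blk l (k * n) i)).
Qed.

Section basis.
Variables (r : nat) (B : 'M[R]_(l * (k * n), r)).
Hypothesis Bo : orthonormal_basis (obs_subspace X) B.

Let coef i (u : 'cV[R]_r) : 'M[R]_k := (X i)^T *m unvec (blk (B *m u) i).

Lemma coefP i u : blk (B *m u) i = vec (X i *m coef i u).
Proof.
have : obs_subspace X (B *m u) by rewrite Bo.2; eexists.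
by move=> /(_ i)[A BuA]; rewrite /coef BuA vecK !mulmxA -(mulmxA (X i)) Xo mulmx1.
Qed.

Lemma coefD i u t e : coef i (u + t *: e) = coef i u + t *: coef i e.
Proof.
rewrite /coef mulmxDr -scalemxAr [in RHS]scalemxAr -[in RHS]mulmxDr; congr (_ *m _).
by apply/matrixP => a b; rewrite !mxE.
Qed.

Let singular := [set u | \prod_i \det (coef i u) = 0].

Lemma measurable_singular : measurable singular.
Proof.
rewrite (_ : singular = (fun u => \prod_i \det (coef i u)) @^-1` [set 0])//.
rewrite -[X in measurable X]setTI.
suff h : measurable_fun setT (fun u => \prod_i \det (coef i u)) by exact: h.
apply: measurable_prod => i _; apply: measurable_det => a b.
rewrite /coef; under eq_fun => u do rewrite mxE.
apply: measurable_sum => c; apply: measurable_funM => //.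
under eq_fun => m do rewrite mxE blkE.
apply: measurableT_comp (measurable_coord _) _.
exact: measurable_mulmx (@measurable_id _ _ _).
Qed.

(** Let [e] be the coordinates of the point whose coefficient matrices are all
    the identity.  Along a line of direction [e] each determinant is a
    characteristic polynomial in the parameter, so the line meets the singular
    points in a finite set. *)
Lemma singular_null : leb r singular = 0%E.
Proof.
have [e Be] : exists e, B *m e = stackv (fun i => vec (X i)).
  have : obs_subspace X (stackv (fun i => vec (X i))).
    by move=> i; exists 1%:M; rewrite blk_stackv mulmx1.
  by rewrite Bo.2 => -[e _ <-]; exists e.
apply: (leb_null_lines (e := e)); first exact: measurable_singular.
move=> u; pose p := \prod_(i < l) char_poly (- coef i u).
have p0 : p != 0.
  by apply: monic_neq0; apply: monic_prod => i _; exact: char_poly_monic.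
have [s hs] := roots_in_seq p0.
apply: (@sub_countable _ _ _ [set` s]); last exact/finite_set_countable/finite_seq.
apply: subset_card_le => t /= ut; apply: hs.
rewrite /root /p horner_prod; apply/eqP; rewrite -[RHS]ut; apply: eq_bigr => i _.
by rewrite coefD /coef Be blk_stackv vecK Xo scalemx1 det_addr_scalar.
Qed.

Lemma posterior_weight_nonsingular u : ~ singular u ->
  posterior_weight K X (B *m u) = gauss_weight (B^T *m M *m B) u.
Proof.
move=> nu; rewrite /posterior_weight big1 ?mulr1; last first.
  move=> i _; rewrite /likelihood indicE mem_set//.
  rewrite coefP; exists (coef i u) => //=.
  rewrite unitmxE unitfE; apply/negP => /eqP d0; apply: nu.
  by rewrite /singular/= (bigD1 i)//= d0 mul0r.
by rewrite /gauss_weight mulNr /quadf trmx_mul !mulmxA.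
Qed.

(** The likelihood is 1 outside the null set of singular points, so it drops
    out once the posterior is written in an orthonormal basis. *)
Lemma integral_posterior_weight (f : 'cV[R]_(l * (k * n)) -> \bar R) :
  measurable_fun setT f -> (forall m, 0 <= f m)%E ->
  (\int[pushforward (leb r) (fun u => (B *m u)%R)]_(m in obs_subspace X)
     (f m * (posterior_weight K X m)%:E)
   = \int[leb r]_u (f (B *m u)%R * (gauss_weight (B^T *m M *m B) u)%:E))%E.
Proof.
move=> mf f0.
have mB : measurable_fun setT (fun u : 'cV[R]_r => B *m u).
  exact: measurable_mulmx.
have mg : measurable_fun setT (fun m => f m * (posterior_weight K X m)%:E)%E.
  apply: emeasurable_funM => //; apply/measurable_EFinP.
  exact: measurable_posterior_weight.
have g0 m : (0 <= f m * (posterior_weight K X m)%:E)%E.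
  by rewrite mule_ge0// lee_fin posterior_weight_ge0.
rewrite (ge0_integral_pushforward mB)//; last 2 first.
- exact: measurable_obs_subspace.
- exact: measurable_funTS.
rewrite (_ : _ @^-1` _ = setT); last first.
  by apply/seteqP; split=> // u _ /=; rewrite Bo.2; eexists.
apply: ge0_ae_eq_integral => //.
- exact: measurableT_comp mg mB.
- apply: emeasurable_funM; first exact: measurableT_comp mf mB.
  by apply/measurable_EFinP; exact: measurable_gauss_weight_cV.
- by move=> u _; exact: g0.
- by move=> u _; rewrite mule_ge0// lee_fin expR_ge0.
exists singular; split; [exact: measurable_singular|exact: singular_null|].
move=> u /= h; apply: contrapT => nu; apply: h => _ /=.
by rewrite posterior_weight_nonsingular.
Qed.

End basis.

End posterior.

(** * The predictive distribution *)

Lemma mixture_probability d1 d2 d3 (T : measurableType d1) (T1 : measurableType d2)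
    (T2 : measurableType d3) (R : realType) (mu : {measure set T -> \bar R})
    (cond : R.-pker T1 ~> T2) (phi : T -> T1) (w : T -> R) :
  measurable_fun setT phi -> measurable_fun setT w -> (forall t, 0 <= w t) ->
  (\int[mu]_t (w t)%:E = 1)%E ->
  exists Q : probability T2 R,
    forall A, Q A = (\int[mu]_t (cond (phi t) A * (w t)%:E))%E.
Proof.
move=> mphi mw w0 w1.
pose Q A : \bar R := (\int[mu]_t (cond (phi t) A * (w t)%:E))%E.
have fge0 A t : (0 <= cond (phi t) A * (w t)%:E)%E by rewrite mule_ge0// lee_fin.
have Q0 : Q set0 = 0%E.
  by apply: integral0_eq => t _; rewrite measure0 mul0e.
have Qge0 A : (0 <= Q A)%E by apply: integral_ge0 => t _; exact: fge0.
have Qsigma : semi_sigma_additive Q.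
  move=> F mF tF mUF.
  rewrite [X in _ --> X](_ : _ = \sum_(n <oo) Q (F n))%E; last first.
    rewrite /Q -integral_nneseries//; last first.
      move=> i; apply: emeasurable_funM; last exact/measurable_EFinP.
      exact: measurableT_comp (measurable_kernel cond _ (mF i)) mphi.
    apply: eq_integral => t _.
    rewrite measure_semi_bigcup// muleC -nneseriesZl//.
    by apply: eq_eseriesr => i _; rewrite muleC.
  by apply/cvg_closeP; split; [exact: is_cvg_nneseries|rewrite closeE].
have QT : Q setT = 1%E.
  by rewrite -w1; apply: eq_integral => t _; rewrite prob_kernel mul1e.
pose m1 := isMeasure.Build _ _ _ Q Q0 Qge0 Qsigma.
pose Qm : {measure set T2 -> \bar R} := HB.pack Q m1.
pose m2 := Measure_isProbability.Build _ _ _ Qm QT.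
pose Qp : probability T2 R := HB.pack Q m1 m2.
by exists Qp.
Qed.

Theorem theorem3p1 (R : realType) (n k l d : nat)
    (hk1 : (1 <= k)%N) (hkn : (k <= n)%N) (hl : (1 <= l)%N) (hd : (1 <= d)%N)
    (Theta : set 'cV[R]_d) (kf : 'cV[R]_d -> 'cV[R]_d -> R)
    (kf_range : forall x y, Theta x -> Theta y -> -1 <= kf x y <= 1)
    (kf_corr : correlation_function Theta kf)
    (theta : 'I_l -> 'cV[R]_d) (theta_in : forall i, Theta (theta i))
    (theta_star : 'cV[R]_d) (theta_star_in : Theta theta_star)
    (X : 'I_l -> 'M[R]_(n, k))
    (X_orthonormal : forall i, (X i)^T *m X i = 1%:M) :
  let K : 'M[R]_l := \matrix_(i, j) kf (theta i) (theta j) in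
  let kl : 'cV[R]_l := \col_i kf theta_star (theta i) in
  let v : 'cV[R]_l := invmx K *m kl in
  let Dv : 'M[R]_l := diag_mx v^T in
  let Kt : 'M[R]_l := invmx (Dv *m K *m Dv) in
  let XX : 'M[R]_(l * n, l * k) := blkdiag X in
  let Sigma : 'M[R]_n :=
    (eps2 K kl)%:M +
    hcat X *m invmx (XX^T *m (Kt *t (1%:M : 'M[R]_n)) *m XX) *m (hcat X)^T in
  K \in unitmx ->
  (forall i, v i ord0 != 0) ->
  forall (J : probability 'cV[R]_((1 + l) * (k * n)) R)
    (cond : R.-pker 'cV[R]_(l * (k * n)) ~> 'cV[R]_(k * n)),
  gpsr_prior K kl J cond ->
  gaussian_dist 0 ((1%:M : 'M[R]_k) *t Sigma) (predictive K X cond).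
Proof.
move=> K kl v Dv Kt XX Sigma Ku v0 J cond [_ _ hcond].
have Kpd : posdef K.
  by apply: psd_unitmx_posdef => //; have [_ + _] := kf_corr; apply.
have s0 (a : 'cV[R]_(k * n)) : 0 <= quadf (eps2 K kl)%:M a by exact: (hcond 0).1.2.
(* read off at a unit vector, which exists as k and n are positive *)
have e0 : 0 <= eps2 K kl.
  have i0 : 'I_(k * n) by apply: (@Ordinal _ 0); rewrite muln_gt0 hk1 (leq_trans hk1).
  have := s0 (delta_mx i0 ord0); rewrite quadf_scalar dotvE (bigD1 i0)//= big1.
    by rewrite !mxE !eqxx mulr1 addr0 mulr1.
  by move=> j ji; rewrite !mxE (negbTE ji) mul0r.
have SigmaE : Sigma = (eps2 K kl)%:M +
    hcat X *m invmx (XX^T *m (Kt *t (1%:M : 'M[R]_n)) *m XX) *m (hcat X)^T by [].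
set P := hcat X *m _ *m _ in SigmaE.
have P0 a : 0 <= quadf P a by exact: quadf_subspace_cov_ge0.
have Ps : P^T = P by exact: subspace_cov_sym.
split.
  apply: psd_tens1mx.
    by rewrite SigmaE linearD/= tr_scalar_mx Ps.
  move=> a; rewrite SigmaE quadfD addr_ge0// quadf_scalar mulr_ge0//.
  exact: dotv_ge0.
have [r [B [Bo SE]]] := subspace_lebesgueE (obs_subspace_basis X_orthonormal).
set M := invmx (K *t (1%:M : 'M[R]_(k * n))).
pose Q := B^T *m M *m B.
have Qpd : posdef Q.
  apply: posdef_congr => [|u]; first exact/posdef_invmx/posdef_tensmx1.
  exact: orthonormal_inj Bo.1.
have [Z Z0 HZ] := gaussian_marginal Qpd.
have intZ : (\int[leb r]_u (gauss_weight Q u)%:E = Z%:E)%E.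
  have := HZ 0 0 0 0 setT; rewrite mulmx0 => /(_ erefl (lexx _) measurableT).
  by under eq_integral do rewrite normal1_setT mul1e; rewrite normal1_setT mule1.
have mB : measurable_fun setT (fun u : 'cV[R]_r => B *m u).
  exact: measurable_mulmx.
have predE A : measurable A -> predictive K X cond A =
    (\int[leb r]_u (cond (B *m u)%R A * (gauss_weight Q u / Z)%:E))%E.
  move=> mA; have mcond := measurable_kernel cond A mA.
  have densE m : (posterior_density K X m = posterior_weight K X m / Z)%R.
    rewrite /posterior_density SE; congr (_ / _).
    have := integral_posterior_weight K X_orthonormal Bo (f := cst 1%E).
    under eq_integral do rewrite mul1e.
    move=> ->//; under eq_integral do rewrite mul1e.
    by rewrite intZ.
  rewrite /predictive SE.
  under eq_integral => m _ do rewrite densE mulrC EFinM muleA.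
  rewrite (integral_posterior_weight K X_orthonormal Bo
    (f := fun m => (cond m A * (Z^-1)%:E)%E))//.
  - by apply: eq_integral => u _; rewrite -muleA -EFinM (mulrC _ Z^-1).
  - exact: emeasurable_funM.
  - by move=> m; rewrite mule_ge0// lee_fin invr_ge0 ltW.
have [Qp QpE] : exists Qp : probability 'cV[R]_(k * n) R, forall A, Qp A =
    (\int[leb r]_u (cond (B *m u)%R A * (gauss_weight Q u / Z)%:E))%E.
  apply: mixture_probability => //.
  - apply: measurable_funM => //; exact: measurable_gauss_weight_cV.
  - by move=> u; rewrite divr_ge0 ?expR_ge0// ltW.
  - under eq_integral do rewrite EFinM.
    rewrite ge0_integralZr//.
    + by rewrite intZ -EFinM mulfV// gt_eqF.
    + by apply/measurable_EFinP; exact: measurable_gauss_weight_cV.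
    + by move=> u _; rewrite lee_fin expR_ge0.
    + by rewrite lee_fin invr_ge0 ltW.
exists Qp; first by move=> A mA; rewrite predE// QpE.
move=> a D mD; rewrite /pushforward QpE.
set g := stackv (fun i => v i ord0 *: a).
have [h [Qh var]] := predictive_variance Kpd v0 X_orthonormal Bo a.
have condE u :
    cond (B *m u) ((fun x => (a^T *m x) ord0 ord0 : measurableTypeR R) @^-1` D)
    = normal1 (dotv (B^T *m g) u + 0) (quadf (eps2 K kl)%:M a) D.
  have [_ [Qu QuE Qun]] := hcond (B *m u).
  rewrite QuE; last first.
    rewrite -[X in measurable X]setTI.
    exact: (measurable_dotv a (@measurable_id _ _ setT)).
  have := Qun a D mD; rewrite /pushforward => ->.
  congr (normal1 _ _ _); rewrite addr0 -dotv_trmx dotv_blk.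
  rewrite /cond_mean -/(dotv _ _) dotv_sumr; apply: eq_bigr => i _.
  by rewrite blk_stackv dotvZr dotvZl.
transitivity (\int[leb r]_u
  (normal1 (dotv (B^T *m g) u + 0)%R (quadf (eps2 K kl)%:M a) D
   * (gauss_weight Q u)%:E * (Z^-1)%:E))%E.
  by apply: eq_integral => u _; rewrite condE EFinM muleA.
rewrite ge0_integralZr//; last 3 first.
- exact: measurable_marginal_integrand.
- by move=> u _; exact: marginal_integrand_ge0.
- by rewrite lee_fin invr_ge0 ltW.
rewrite (HZ _ h)// muleAC -EFinM mulfV ?gt_eqF// mul1e mulmx0 mxE.
congr (normal1 _ _ _); rewrite var -[RHS]/(quadf _ _) quadf_tens1mx SigmaE.
rewrite quadf_scalar dotv_blk mulr_sumr -big_split/=; apply: eq_bigr => j _.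
by rewrite quadfD quadf_scalar.
Qed.
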